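(* Let $G$ be a finite simple $2$-connected graph. If $G$ is $\{K_{1,3},N_{1,1,2},H_{1,1}\}$-heavy, then $G$ is Hamiltonian.
   Context: Let $G$ be a graph on $n$ vertices. An induced subgraph $H'$ of $G$ is called heavy if there exist two nonadjacent vertices in $H'$ whose degree sum in $G$ is at least $n$. For a graph $H$, $G$ is $H$-heavy if every induced subgraph of $G$ isomorphic to $H$ is heavy; for a family $\mathcal{H}$, $G$ is $\mathcal{H}$-heavy if it is $H$-heavy for every $H\in\mathcal{H}$. $K_{1,3}$ is the claw (star with three leaves). $N_{1,1,2}$ is the graph on 7 vertices obtained from a triangle $abc$ by attaching a pendant edge at $a$, a pendant edge at $b$, and a pendant path of length $2$ at $c$. $H_{1,1}$ is the graph on 7 vertices obtained from the hourglass (two triangles $cab$ and $cde$ sharing exactly the vertex $c$) by attaching one pendant edge at $a$ and one pendant edge at $b$. *)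

(* Defs.v *)
From Stdlib Require List.
From mathcomp Require Import all_boot.

Set Implicit Arguments.
Unset Strict Implicit.
Unset Printing Implicit Defensive.

Record sgraph := SGraph {
  vertex :> finType;
  adj : rel vertex;
  adj_sym : symmetric adj;
  adj_irrefl : irreflexive adj }.

Definition degree (G : sgraph) (x : G) : nat := #|[set y | adj x y]|.

Section Induced.
Variables (G : sgraph) (S : {set G}).

Definition induced_adj : rel {x : G | x \in S} :=
  fun u v => adj (val u) (val v).

Lemma induced_adj_sym : symmetric induced_adj.
Proof. by move=> u v; apply: adj_sym. Qed.

Lemma induced_adj_irrefl : irreflexive induced_adj.
Proof. by move=> u; apply: adj_irrefl. Qed.

Definition induced : sgraph := SGraph induced_adj_sym induced_adj_irrefl.
End Induced.

Definition isomorphic (G H : sgraph) : Prop :=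
  exists2 f : G -> H, bijective f & forall x y, adj (f x) (f y) = adj x y.

Definition connected (G : sgraph) : Prop :=
  0 < #|G| /\ forall x y : G, connect (@adj G) x y.

(* The bound k < #|G| excludes small complete graphs: a 2-connected graph has
   at least three vertices. *)
Definition k_connected (k : nat) (G : sgraph) : Prop :=
  k < #|G| /\ forall X : {set G}, #|X| < k -> connected (induced (~: X)).

(* [ucycle] accepts the one-edge sequence [:: x; y]; hence the size bound. *)
Definition hamiltonian (G : sgraph) : Prop :=
  exists c : seq G,
    [/\ 2 < size c, ucycle (@adj G) c & forall x : G, x \in c].

(* Degrees are taken in G, not in the subgraph induced by S. *)
Definition heavy (G : sgraph) (S : {set G}) : Prop :=
  exists x y : G, [/\ x \in S, y \in S, x != y, ~~ adj x y
                    & #|G| <= degree x + degree y].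

Definition H_heavy (H G : sgraph) : Prop :=
  forall S : {set G}, isomorphic (induced S) H -> heavy S.

Definition family_heavy (Hs : seq sgraph) (G : sgraph) : Prop :=
  forall H : sgraph, List.In H Hs -> H_heavy H G.

Section EdgeList.
Variables (n : nat) (E : seq (nat * nat)).

Definition edge_list_adj : rel 'I_n :=
  fun i j => (i != j) &&
    (((i : nat, j : nat) \in E) || ((j : nat, i : nat) \in E)).

Lemma edge_list_adj_sym : symmetric edge_list_adj.
Proof. by move=> i j; rewrite /edge_list_adj eq_sym orbC. Qed.

Lemma edge_list_adj_irrefl : irreflexive edge_list_adj.
Proof. by move=> i; rewrite /edge_list_adj eqxx. Qed.

Definition edge_list_graph : sgraph :=
  SGraph edge_list_adj_sym edge_list_adj_irrefl.
End EdgeList.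

(* K_{1,3}, with centre 0. *)
Definition claw : sgraph := edge_list_graph 4 [:: (0, 1); (0, 2); (0, 3)].

(* N_{1,1,2}: triangle a = 0, b = 1, c = 2; pendant edges a-3 and b-4;
   pendant path c-5-6. *)
Definition N112 : sgraph :=
  edge_list_graph 7
    [:: (0, 1); (0, 2); (1, 2); (0, 3); (1, 4); (2, 5); (5, 6)].

(* H_{1,1}: hourglass with centre c = 0 and triangles c a b = 0 1 2 and
   c d e = 0 3 4; pendant edges a-5 and b-6. *)
Definition H11 : sgraph :=
  edge_list_graph 7
    [:: (0, 1); (0, 2); (1, 2); (0, 3); (0, 4); (3, 4); (1, 5); (2, 6)].

(* Main.v *)
Require Import Defs.
From mathcomp Require Import all_boot zify.

Set Implicit Arguments.
Unset Strict Implicit.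
Unset Printing Implicit Defensive.

(** Write [x ~ y] when [x] and [y] are adjacent or have degree sum at least [n].
    A longest [~]-cycle [C] through all vertices of degree at least [n/2] can be
    taken to be a genuine cycle (Ore's crossing argument).  If it misses a vertex,
    a path off [C] joins two of its vertices [a] and [b], and the claw condition
    makes the two neighbours of [a] on [C], and likewise those of [b], [~]-adjacent:
    three paths join a triangle at [a] to a triangle at [b].  Both triangles are
    grown to maximal junctions [A] and [B], which a cycle can traverse between any
    two exits.  Since no [~]-cycle covers [C] and a vertex off [C], [~] between [A]
    and [B] is confined to corresponding exits, so at most one of [A], [B] contains
    a nonadjacent pair with degree sum at least [n]; say [A] contains none.
    In [A] the relations [~] and adjacency agree, and claw-freeness makes the exits
    of [A] a triangle, or else [N_{1,1,2}] occurs.  Prolonging the path off [C]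
    then gives [N_{1,1,2}] or [H_{1,1}] unless [a] and a vertex at distance two
    have degree sum at least [n], and this contradicts a count of neighbours. *)

Section OreAdjacency.
Variable G : sgraph.
Implicit Types (x y z c : G) (s p : seq G).

Definition oadj : rel G :=
  [rel x y | (x != y) && (adj x y || (#|G| <= degree x + degree y))].

Definition apart : rel G := [rel x y | (x != y) && ~~ oadj x y].

Lemma adj_neq x y : adj x y -> x != y.
Proof. by move=> xy; apply/eqP => E; rewrite E adj_irrefl in xy. Qed.

Lemma adj_oadj x y : adj x y -> oadj x y.
Proof. by move=> xy; rewrite /oadj /= adj_neq // xy. Qed.

Lemma oadj_sym : symmetric oadj.
Proof. by move=> x y; rewrite /oadj /= eq_sym adj_sym addnC. Qed.

Lemma apart_sym : symmetric apart.
Proof. by move=> x y; rewrite /apart /= eq_sym oadj_sym. Qed.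

Lemma apartP x y :
  reflect [/\ x != y, ~~ adj x y & degree x + degree y < #|G|] (apart x y).
Proof.
rewrite /apart /oadj /=; case: (altP (x =P y)) => //= _.
  by constructor => -[].
by rewrite negb_or -ltnNge; apply: (iffP andP) => -[].
Qed.

Lemma apart_adjN x y : apart x y -> adj x y = false.
Proof. by case/apartP => _ /negbTE. Qed.

Lemma heavy_oadj x y :
  x != y -> #|G| <= (degree x).*2 -> #|G| <= (degree y).*2 -> oadj x y.
Proof.
by move=> xy hx hy; rewrite /oadj /= xy; apply/orP; right;
   rewrite -leq_double doubleD -addnn leq_add.
Qed.

Lemma heavy_copy n (E : seq (nat * nat)) (f : 'I_n -> G) :
  H_heavy (edge_list_graph n E) G ->
  (forall i j : 'I_n, i < j ->
     if ((i : nat, j : nat) \in E) || ((j : nat, i : nat) \in E)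
     then adj (f i) (f j) else apart (f i) (f j)) ->
  False.
Proof.
move=> hG hf.
have fneq (i j : 'I_n) : i != j -> f i != f j.
  wlog ij : i j / i < j => [W|].
    case: (ltngtP i j) => [||/val_inj ->]; first exact: W.
    - by move=> ji; rewrite eq_sym [f i == _]eq_sym; apply: W.
    - by rewrite eqxx.
  move: (hf _ _ ij); case: ifP => _; first by move/adj_neq.
  by case/andP.
have finj : injective f.
  by move=> i j /eqP; case: (altP (i =P j)) => // /fneq /negbTE ->.
pose S := [set x in codom f].
have inS i : f i \in S by rewrite inE codom_f.
have adjE (i j : 'I_n) : adj (f i) (f j) = edge_list_adj E i j.
  rewrite /edge_list_adj.
  wlog ij : i j / i < j => [W|].
    case: (ltngtP i j) => [||/val_inj ->]; first exact: W.
    - by move=> ji; rewrite adj_sym eq_sym orbC; apply: W.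
    - by rewrite eqxx adj_irrefl.
  have -> /= : i != j by apply/eqP => e; rewrite e ltnn in ij.
  by move: (hf _ _ ij); case: ifP => _ // /apart_adjN.
have heavyS : heavy S.
  apply: hG; have cod (u : induced S) : val u \in codom f.
    by have := valP u; rewrite inE.
  exists (fun u => iinv (cod u)).
    exists (fun i => Sub (f i) (inS i)) => [u|i].
      by apply: val_inj; rewrite /= f_iinv.
    by apply: finj; rewrite f_iinv.
  move=> u v; rewrite -[LHS]/(edge_list_adj E _ _) -adjE !f_iinv.
  by [].
case: heavyS => x [y [xS yS xy nxy hd]].
move: xS yS; rewrite !inE => /codomP[i Ei] /codomP[j Ej]; subst x y.
wlog ij : i j xy nxy hd / i < j => [W|].
  case: (ltngtP i j) => [||/val_inj e]; first exact: (W i j).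
    by apply: W; rewrite 1?eq_sym 1?adj_sym 1?addnC.
  by rewrite e eqxx in xy.
move: (hf _ _ ij); case: ifP => _; first by rewrite (negbTE nxy).
by case/apartP => _ _; lia.
Qed.

Lemma claw_heavy_oadj c x y z :
  H_heavy claw G -> adj c x -> adj c y -> adj c z ->
  apart x y -> apart x z -> apart y z -> False.
Proof.
move=> hG cx cy cz xy xz yz.
apply: (@heavy_copy 4 _ (fun i => nth c [:: c; x; y; z] i) hG).
by move=> [[|[|[|[|i]]]] //= Hi] [[|[|[|[|j]]]] //= Hj].
Qed.

Lemma N112_heavy_apart a b c a' b' c' c'' :
  H_heavy N112 G ->
  adj a b -> adj a c -> adj b c -> adj a a' -> adj b b' -> adj c c' ->
  adj c' c'' ->
  apart a b' -> apart a c' -> apart a c'' ->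
  apart b a' -> apart b c' -> apart b c'' ->
  apart c a' -> apart c b' -> apart c c'' ->
  apart a' b' -> apart a' c' -> apart a' c'' ->
  apart b' c' -> apart b' c'' -> False.
Proof.
move=> hG; intros.
apply: (@heavy_copy 7 _ (fun i => nth a [:: a; b; c; a'; b'; c'; c''] i) hG).
by move=> [[|[|[|[|[|[|[|i]]]]]]] //= Hi] [[|[|[|[|[|[|[|j]]]]]]] //= Hj] //=;
   rewrite /= apart_sym.
Qed.

Lemma H11_heavy_apart c a b d e a' b' :
  H_heavy H11 G ->
  adj c a -> adj c b -> adj a b -> adj c d -> adj c e -> adj d e ->
  adj a a' -> adj b b' ->
  apart a d -> apart a e -> apart b d -> apart b e ->
  apart c a' -> apart c b' -> apart a b' -> apart b a' -> apart a' b' ->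
  apart d a' -> apart d b' -> apart e a' -> apart e b' -> False.
Proof.
move=> hG; intros.
apply: (@heavy_copy 7 _ (fun i => nth a [:: c; a; b; d; e; a'; b'] i) hG).
by move=> [[|[|[|[|[|[|[|i]]]]]]] //= Hi] [[|[|[|[|[|[|[|j]]]]]]] //= Hj] //=;
   rewrite /= apart_sym.
Qed.

End OreAdjacency.

Lemma count_consecutive (T : Type) (P Q : pred T) x s :
  path (fun y z => ~~ (P y && Q z)) x s ->
  count P (x :: s) + count Q (x :: s) <= size s + P (last x s) + Q x.
Proof.
elim: s x => [|y s IHs] x; first by rewrite /= !addn0 add0n.
rewrite [path _ _ _]/= => /andP[nPQ /IHs] le_s.
have le_xy : P x + Q y <= 1 by case: (P x) (Q y) nPQ => -[].
by move: le_s le_xy => /=; lia.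
Qed.

Lemma path_breakP (T : Type) (e : rel T) x s :
  ~~ path e x s -> exists p y q, s = p ++ y :: q /\ ~~ e (last x p) y.
Proof.
elim: s x => //= y s IHs x; case: (boolP (e x y)) => [_|exy _].
  by case/IHs => p [z [q [-> ezN]]]; exists (y :: p), z, q.
by exists [::], y, s.
Qed.

Lemma cycle_breakP (T : Type) (e : rel T) s :
  ~~ cycle e s -> exists i x p, rot i s = x :: p /\ ~~ e (last x p) x.
Proof.
case: s => //= x s nc; have [p [y [q]]] := path_breakP nc.
case/lastP: q => [|q z] [].
  rewrite cats1 => /rcons_inj[<- <-] exy; exists 0, x, s.
  by rewrite rot0.
rewrite -rcons_cons -rcons_cat => /rcons_inj[-> _] exy.
exists (size (x :: p)), y, (q ++ x :: p); split; last by rewrite last_cat.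
by rewrite -cat_cons rot_size_cat.
Qed.

Section CycleDefects.
Variables (T : eqType) (e : rel T).
Hypothesis e_sym : symmetric e.

Definition defects x s := sumn (pairmap (fun y z => nat_of_bool (~~ e y z)) x s).

Definition cycle_defects s := if s is x :: p then defects x (rcons p x) else 0.

Lemma defects_cat x s t : defects x (s ++ t) = defects x s + defects (last x s) t.
Proof. by rewrite /defects pairmap_cat sumn_cat. Qed.

Lemma defects_rev x s : defects (last x s) (rev (belast x s)) = defects x s.
Proof.
elim: s x => //= y s IHs x; rewrite rev_cons -cats1 defects_cat IHs addnC.
have -> : last (last y s) (rev (belast y s)) = y.
  by case: s {IHs} => //= z s; rewrite rev_cons last_rcons.
by rewrite /defects /= e_sym addn0.
Qed.

Lemma cycle_defects_cat x s y t :
  cycle_defects ((x :: s) ++ y :: t) =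
  defects x s + ~~ e (last x s) y + defects y t + ~~ e (last y t) x.
Proof.
rewrite /= -cats1 -catA defects_cat /= -[y :: _]/([:: y] ++ _).
by rewrite !defects_cat /defects /= !addn0 !addnA.
Qed.

Lemma cycle_defects_rot i s : cycle_defects (rot i s) = cycle_defects s.
Proof.
rewrite /rot -[in RHS](cat_take_drop i s).
case: (take i s) (drop i s) => [|x p] [|y q]; rewrite ?cats0 //.
by rewrite !cycle_defects_cat; lia.
Qed.

Lemma cycle_defects_cross x s y t :
  e x y -> e (last y t) (last x s) -> ~~ e (last y t) x ->
  cycle_defects ((x :: s) ++ rev (y :: t)) < cycle_defects ((x :: s) ++ y :: t).
Proof.
move=> xy ts tx; rewrite cycle_defects_cat tx.
rewrite [y :: t]lastI rev_rcons cycle_defects_cat e_sym ts defects_rev.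
have -> : last (last y t) (rev (belast y t)) = y.
  by case: t {ts tx} => //= z t; rewrite rev_cons last_rcons.
by rewrite [e y x]e_sym xy /=; lia.
Qed.

End CycleDefects.

Section OreCycles.
Variable G : sgraph.
Implicit Types (x y z c : G) (s p C : seq G).

Lemma degree_split x s : uniq s ->
  degree x = count (adj x) s + #|[set y | adj x y & y \notin s]|.
Proof.
move=> us; rewrite /degree -(cardsID [set y in s]); congr (_ + _).
  rewrite -size_filter -(card_uniqP (filter_uniq _ us)); apply: eq_card => y.
  by rewrite !inE mem_filter.
by apply: eq_card => y; rewrite !inE andbC.
Qed.

Lemma card_notin s : uniq s -> size s + #|[set y : G | y \notin s]| = #|G|.
Proof.
move=> us; rewrite -(card_uniqP us) -(cardC (mem s)); congr (_ + _).
by apply: eq_card => y; rewrite !inE.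
Qed.

Lemma oadj_path_rev x p :
  path (@oadj G) (last x p) (rev (belast x p)) = path (@oadj G) x p.
Proof. by rewrite rev_path; apply: eq_path => y z; apply: oadj_sym. Qed.

Lemma cycle_oadj_cross x s y t :
  cycle (@oadj G) ((x :: s) ++ y :: t) ->
  oadj x y -> oadj (last y t) (last x s) ->
  cycle (@oadj G) ((x :: s) ++ rev (y :: t)).
Proof.
move=> + xy ts; rewrite /= !rcons_path !cat_path !last_cat /=.
case/andP=> /and3P[-> _ pt] _ /=.
have -> : last (last x s) (rev (y :: t)) = y by rewrite rev_cons last_rcons.
rewrite oadj_sym xy andbT [y :: t]lastI rev_rcons /= oadj_sym ts.
by rewrite oadj_path_rev.
Qed.

Lemma real_cycle (s0 : seq G) : ucycle (@oadj G) s0 ->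
  exists C, [/\ ucycle (@adj G) C, {subset s0 <= C} &
    forall t, ucycle (@oadj G) t -> {subset C <= t} -> size t <= size C].
Proof.
move=> us0; pose ok t := ucycleb (@oadj G) t && all (mem t) s0.
pose P n := [exists t : n.-tuple G, ok t].
have okP t : ok t -> P (size t) by move=> okt; apply/existsP; exists (in_tuple t).
have exP : exists n, P n.
  exists (size s0); apply: okP; apply/andP; split=> //; exact/allP.
have boundP n : P n -> n <= #|G|.
  case/existsP => t /andP[/andP[_ ut] _].
  by rewrite -(size_tuple t) -(card_uniqP ut) max_card.
case: (ex_maxnP exP boundP) => n /existsP[t0 okt0] maxn.
case: (@arg_minnP _ t0 (fun t : n.-tuple G => ok t)
  (fun t => cycle_defects (@adj G) t) okt0) => C okC minC.
have maxC t : ok t -> size t <= size C by move=> /okP /maxn; rewrite size_tuple.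
have [/andP[cC uC] /allP sC] := andP okC.
exists C; split=> //; last first.
  move=> t ut sCt; apply: maxC; apply/andP; split=> //; apply/allP => x x0.
  by apply: sCt; apply: sC.
rewrite /ucycle uC andbT; case: (boolP (cycle (@adj G) C)) => // /cycle_breakP.
case=> i [u [q [Ei nvu]]]; exfalso; set v := last u q in nvu.
have [cq uq] : cycle (@oadj G) (u :: q) /\ uniq (u :: q).
  by rewrite -Ei rot_cycle rot_uniq.
have memC : C =i u :: q by move=> z; rewrite -Ei mem_rot.
have sizeq : size (u :: q) = n by rewrite -Ei size_rot size_tuple.
have okq t : cycle (@oadj G) t -> uniq t -> {subset u :: q <= t} -> ok t.
  move=> ct ut st; rewrite /ok /ucycleb ct ut; apply/allP => z z0.
  by apply: st; rewrite -memC; apply: sC.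
have vu : oadj v u by move: cq; rewrite /= rcons_path => /andP[].
have dvu : #|G| <= degree v + degree u.
  by case/andP: vu => _; rewrite (negbTE nvu).
have := @count_consecutive _ (adj v) (adj u) u q.
case: (boolP (path _ u q)) => [_ /(_ isT)|nb _].
  rewrite !adj_irrefl !addn0 => le_count.
  have disj : [disjoint [set y | adj v y & y \notin u :: q] &
                        [set y | adj u y & y \notin u :: q]].
    apply/pred0P => z /=; rewrite !in_set; apply/negP.
    case/andP=> /andP[vz zq] /andP[uz _].
    have : ok (u :: rcons q z).
      apply: okq; last by move=> y; rewrite !inE mem_rcons inE => /orP[]->; rewrite ?orbT.
      - move: cq; rewrite /= !rcons_path last_rcons => /andP[-> _].
        by rewrite !adj_oadj // adj_sym.
      - by rewrite -rcons_cons rcons_uniq zq uq.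
    by move/maxC; rewrite /= size_rcons size_tuple -sizeq ltnn.
  have le_off : #|[set y | adj v y & y \notin u :: q]| +
      #|[set y | adj u y & y \notin u :: q]| <= #|[set y : G | y \notin u :: q]|.
    rewrite -cardsUI (eqP (_ : _ :&: _ == set0)) ?setI_eq0 // cards0 addn0.
    by apply/subset_leq_card/subsetP => z; rewrite !in_set => /orP[] /andP[].
  move: dvu (card_notin uq); rewrite (degree_split v uq) (degree_split u uq) /=.
  by move: le_off le_count => /=; lia.
have [p [w [r [Eq]]]] := path_breakP nb.
rewrite negbK => /andP[vp uw].
have cr : cycle (@oadj G) ((u :: p) ++ rev (w :: r)).
  apply: cycle_oadj_cross; rewrite ?adj_oadj //; first by rewrite /= -Eq.
  by have -> : last w r = v by rewrite /v Eq last_cat.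
have pr : perm_eq ((u :: p) ++ rev (w :: r)) (u :: q).
  by rewrite Eq -cat_cons perm_cat2l perm_rev.
have sz : size ((u :: p) ++ rev (w :: r)) == n.
  by rewrite (perm_size pr) -Ei size_rot size_tuple.
have := minC (Tuple sz); rewrite /= => /(_ _) min'.
have {}min' : cycle_defects (@adj G) C <= cycle_defects (@adj G) ((u :: p) ++ rev (w :: r)).
  apply: min'; apply: okq; rewrite ?(perm_uniq pr) //.
  by move=> z; rewrite (perm_mem pr).
move: min'; rewrite -(@cycle_defects_rot _ (@adj G) i) Ei Eq leqNgt => /negP; apply.
apply: cycle_defects_cross => //; first exact: adj_sym.
- by have -> : last w r = v by rewrite /v Eq last_cat.
- by have -> : last w r = v by rewrite /v Eq last_cat.
Qed.

End OreCycles.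

Lemma path_first_hit (T : eqType) (e : rel T) (P : pred T) x s :
  path e x s -> ~~ P x -> P (last x s) ->
  exists p y, [/\ path e x p, e (last x p) y, P y, ~~ has P (x :: p)
                & {subset rcons p y <= s}].
Proof.
elim: s x => [|y s IHs] x /=; first by move=> _ /negP.
case/andP=> xy ps nPx Pl; case: (boolP (P y)) => [Py|nPy].
  exists [::], y; split=> //=; first by rewrite orbF.
  by move=> z; rewrite !inE => ->.
have [p [z [pp ez Pz hp sp]]] := IHs y ps nPy Pl.
exists (y :: p), z; split=> //=; first by rewrite xy.
  by rewrite negb_or nPx.
by move=> t; rewrite !inE => /orP[->//|tp]; rewrite sp ?orbT.
Qed.

Section TwoConnected.
Variable G : sgraph.
Hypothesis connG : k_connected 2 G.
Implicit Types (x y c : G) (C : seq G).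

Lemma path_avoiding x y c : x != c -> y != c ->
  exists p, [/\ path (@adj G) x p, last x p = y, c \notin x :: p & uniq (x :: p)].
Proof.
move=> xc yc; have [_ connS] := connG.
have [_ cxy] : connected (induced (~: [set c])) by apply: connS; rewrite cards1.
have inS z : z != c -> z \in ~: [set c] by rewrite !inE.
pose x' : induced (~: [set c]) := Sub x (inS x xc).
pose y' : induced (~: [set c]) := Sub y (inS y yc).
have /connectP[p pp Ey] := cxy x' y'.
have pv : path (@adj G) x (map val p) by rewrite -[x]/(val x') path_map; exact: pp.
have lv : last x (map val p) = y by rewrite -[x]/(val x') last_map -Ey; exact: erefl.
have cv : c \notin x :: map val p.
  rewrite inE eq_sym (negbTE xc); apply/mapP => -[z _ Ec].
  by have := valP z; rewrite -Ec !inE eqxx.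
case: (shortenP pv) lv => q pq uq sq lq; exists q; split=> //.
by apply: contra cv; rewrite !inE => /orP[->//|/sq ->]; rewrite orbT.
Qed.

Lemma another_vertex x y : exists2 z, z != x & z != y.
Proof.
have [G3 _] := connG; apply/exists_inP; apply: contraLR G3 => /exists_inPn h.
rewrite -leqNgt (leq_trans _ (card_size [:: x; y])) //.
apply/subset_leq_card/subsetP => z _; rewrite !inE.
by have := h z; rewrite unfold_in; case: (z =P x) => //= _ /(_ isT); rewrite negbK.
Qed.

Lemma neighbour_avoiding x c : x != c -> exists2 y, adj x y & y != c.
Proof.
move=> xc; have [z zx zc] := another_vertex x c.
have [[|y p] [/= pp Ez cp _]] := path_avoiding xc zc.
  by rewrite Ez eqxx in zx.
case/andP: pp => xy _; exists y => //.
by move: cp; rewrite !inE !negb_or eq_sym [c == y]eq_sym => /and3P[].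
Qed.

Lemma cycle_through_oadj x y : oadj x y ->
  exists s, [/\ ucycle (@oadj G) s, 2 < size s, x \in s & y \in s].
Proof.
move=> xy; have [x_y _] := andP xy.
have [z xz zy] := neighbour_avoiding x_y.
have [zx yx] : z != x /\ y != x by rewrite !(eq_sym _ x) adj_neq.
have [p [pp Ey xp up]] := path_avoiding zx yx.
have {}pp : path (@oadj G) z p by apply: sub_path pp => u v; apply: adj_oadj.
exists (x :: z :: p); split.
- rewrite /ucycle cons_uniq xp up !andbT /= rcons_path Ey pp adj_oadj //=.
  by rewrite oadj_sym.
- by case: p Ey {pp xp up} => //= Ez; rewrite Ez eqxx in zy.
- by rewrite mem_head.
- by rewrite -Ey inE mem_last orbT.
Qed.

Lemma cycle_through_heavy :
  exists s, [/\ ucycle (@oadj G) s, 2 < size s &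
    forall x, #|G| <= (degree x).*2 -> x \in s].
Proof.
pose heavies := enum [pred x : G | #|G| <= (degree x).*2].
have mem_h x : (x \in heavies) = (#|G| <= (degree x).*2) by rewrite mem_enum.
have uh : uniq heavies by apply: enum_uniq.
have short x y : oadj x y -> (forall z, z \in heavies -> (z == x) || (z == y)) ->
    exists s, [/\ ucycle (@oadj G) s, 2 < size s &
      forall x, #|G| <= (degree x).*2 -> x \in s].
  move=> /cycle_through_oadj[s [cs s2 xs ys]] h; exists s; split=> // z.
  by rewrite -mem_h => /h /orP[]/eqP->.
have [G3 _] := connG; have /card_gt0P[x0 _] : 0 < #|G| by apply: leq_trans G3.
have nbr x : exists y, oadj x y.
  have [c cx _] := another_vertex x x.
  have [|y xy _] := @neighbour_avoiding x c; first by rewrite eq_sym.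
  by exists y; apply: adj_oadj.
case Eh: heavies => [|x [|y [|z s]]].
- have [y x0y] := nbr x0; apply: short x0y _ => z; by rewrite Eh.
- have [y xy] := nbr x; apply: short xy _ => z; by rewrite Eh inE => ->.
- apply: (short x y); last by move=> z; rewrite Eh !inE.
  move: uh; rewrite Eh /= inE andbT => x_y.
  by apply: heavy_oadj; rewrite -?mem_h ?Eh ?inE ?eqxx ?orbT.
exists heavies; split; rewrite ?Eh //; last by move=> t; rewrite -mem_h Eh.
rewrite -Eh /ucycle uh andbT.
have clique : {in heavies &, forall u v, u != v -> oadj u v}.
  by move=> u v; rewrite !mem_h => hu hv uv; apply: heavy_oadj.
rewrite Eh in uh clique *; rewrite (cycle_catC _ [:: x] [:: y, z & s]).
have pairs : pairwise (fun u v => (u != v)) (x :: y :: z :: s).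
  by rewrite -uniq_pairwise.
have sub : pairwise (@oadj G) (x :: y :: z :: s).
  apply: (sub_in_pairwise (P := mem (x :: y :: z :: s))) pairs; first exact: clique.
  exact/allP.
have -> : cycle (@oadj G) ([:: y, z & s] ++ [:: x]) =
          cycle (@oadj G) (x :: [:: y, z & s]) by rewrite -(cycle_catC _ [:: x]).
have [last_in x_last] : last z s \in z :: s /\ x != last z s.
  split; first exact: mem_last.
  apply/eqP => E; move: uh; rewrite cons_uniq inE negb_or => /andP[/andP[_]].
  by rewrite E mem_last.
rewrite /= rcons_path /=; move/pairwise_sorted: sub => /= /and3P[-> -> ->] /=.
by apply: clique; rewrite ?inE ?eqxx // 1?eq_sym // -in_cons last_in !orbT.
Qed.

Lemma maximal_cycle :
  exists C, [/\ ucycle (@adj G) C, 2 < size C,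
    forall x, #|G| <= (degree x).*2 -> x \in C &
    forall t, ucycle (@oadj G) t -> {subset C <= t} -> size t <= size C].
Proof.
have [s [cs s2 hs]] := cycle_through_heavy.
have [C [cC sC maxC]] := real_cycle cs.
exists C; split=> //; last by move=> x /hs /sC.
apply: leq_trans s2 _; apply: uniq_leq_size => //; by case/andP: cs.
Qed.

Lemma bridging_path C : 1 < size C -> uniq C -> (exists z, z \notin C) ->
  exists a b x p, [/\ a \in C, b \in C & a != b] /\
    [/\ path (@adj G) x p, uniq (x :: p), adj a x, adj (last x p) b
      & ~~ has (mem C) (x :: p)].
Proof.
case: C => [|c0 [|c1 C]] // _ uC [z zC]; set D := [:: c0, c1 & C] in zC *.
have c01 : c0 != c1 by move: uC; rewrite /= inE negb_or => /andP[/andP[]].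
have [zc1 D0 D1] : [/\ z != c1, c0 \in D & c1 \in D].
  by move: zC; rewrite !inE !negb_or !eqxx !orbT => /and3P[].
have [p [pp Ec _ _]] := path_avoiding zc1 c01.
have [|q [a [_ xa aD hq _]]] := path_first_hit (P := mem D) pp zC.
  by rewrite Ec.
set x := last z q in xa.
have xD : x \notin D.
  by apply: (contra _ hq) => xD; apply/hasP; exists x => //; apply: mem_last.
have [b0 b0D b0a] : exists2 b, b \in D & b != a.
  by case: (eqVneq c0 a) => [<-|]; [exists c1; rewrite // eq_sym | exists c0].
have [r [pr Eb ar ur]] := path_avoiding (adj_neq xa) b0a.
have [|s [b [ps lb bD hs sub]]] := path_first_hit (P := mem D) pr xD.
  by rewrite Eb.
case: (shortenP ps) lb => t pt ut st lb; exists a, b, x, t.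
split; split=> //.
- by apply: contra ar => /eqP->; rewrite inE sub ?orbT // mem_rcons mem_head.
- by rewrite adj_sym.
- apply: contra hs => /hasP[y yt yD]; apply/hasP; exists y => //.
  by move: yt; rewrite !inE => /orP[->//|/st ->]; rewrite orbT.
Qed.

End TwoConnected.

Ltac perm_count :=
  let P := fresh "P" in apply/permP => P;
  repeat match goal with
    H : is_true (perm_eq _ _) |- _ => move: {H} (permP H P)
  end;
  repeat match goal with H : ?T |- _ =>
    match type of T with Prop => clear H end
  end;
  do 4 rewrite /= ?(count_cat, count_rev); rewrite /=; lia.

Section Spans.
Variable G : sgraph.
Implicit Types (x y z u v w r q : G) (s t p A S T : seq G).

Definition span s x y :=
  exists p, [/\ perm_eq (x :: p) s, path (@oadj G) x p & last x p = y].

Lemma span1 x : span [:: x] x x.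
Proof. by exists [::]. Qed.

Lemma span_path x p : path (@oadj G) x p -> span (x :: p) x (last x p).
Proof. by exists p. Qed.

Lemma span_perm s t x y : perm_eq s t -> span s x y -> span t x y.
Proof. by move=> st [p [ps pp lp]]; exists p; split=> //; apply: perm_trans st. Qed.

Lemma span_sym s x y : span s x y -> span s y x.
Proof.
case=> p [ps pp <-]; exists (rev (belast x p)); split.
- apply: perm_trans ps; rewrite -rev_rcons -lastI; exact: permEl (perm_rev _).
- by rewrite oadj_path_rev.
- by case: p {ps pp} => //= z p; rewrite rev_cons last_rcons.
Qed.

Lemma span_cat s t x y z w :
  span s x y -> oadj y z -> span t z w -> span (s ++ t) x w.
Proof.
case=> p [ps pp <-] yz [q [qt qq <-]]; exists (p ++ z :: q); split.
- by rewrite -cat_cons perm_cat.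
- by rewrite cat_path pp /= yz.
- by rewrite last_cat.
Qed.

Lemma span_cons v s x y : oadj x v -> span s x y -> span (v :: s) v y.
Proof. by rewrite oadj_sym => vx; apply: span_cat (span1 v) vx. Qed.

Lemma span_rcons v s x y : oadj y v -> span s x y -> span (v :: s) x v.
Proof.
by move=> yv xy; apply: span_sym; apply: span_cons yv _; exact: span_sym.
Qed.

Lemma span_cycle s x y : span s x y -> oadj x y ->
  exists2 c, perm_eq c s & cycle (@oadj G) c.
Proof.
case=> p [ps pp lp] xy; exists (x :: p) => //.
by rewrite /= rcons_path pp lp oadj_sym.
Qed.

Definition split_span A x y z w :=
  exists S T, [/\ perm_eq (S ++ T) A, span S x y & span T z w].

Lemma split_span_sym A x y z w : split_span A x y z w -> split_span A x y w z.
Proof. by case=> S [T [ST xy zw]]; exists S, T; split=> //; apply: span_sym. Qed.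

Lemma split_span_grow_l A v u x y z :
  oadj u v -> split_span A x u y z -> split_span (v :: A) x v y z.
Proof.
move=> uv [S [T [ST xu yz]]]; exists (v :: S), T; split=> //.
  by perm_count.
exact: span_rcons uv xu.
Qed.

Lemma split_span_grow_r A v u x y z :
  oadj u v -> split_span A x y u z -> split_span (v :: A) x y v z.
Proof.
move=> uv [S [T [ST xy uz]]]; exists S, (v :: T); split=> //.
  by perm_count.
exact: span_cons uv uz.
Qed.

(* Three paths leave the junction [A] at [u1], [u2] and [u3]; the split fields
   serve cycles with a fourth passage, attached at a vertex [r] of [A].  Two
   available pairings at an inner [r] are what makes the fourth passage close up
   into one cycle, whatever the pairing at the other junction. *)
Record junction A u1 u2 u3 : Prop := Junction {
  span12 : span A u1 u2;
  span13 : span A u1 u3;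
  span23 : span A u2 u3;
  split1 : split_span A u1 u1 u2 u3;
  split2 : split_span A u2 u2 u1 u3;
  split3 : split_span A u3 u3 u1 u2;
  split_inner r : r \in A -> r != u1 -> r != u2 -> r != u3 ->
    [\/ split_span A r u1 u2 u3 /\ split_span A r u2 u1 u3,
        split_span A r u1 u2 u3 /\ split_span A r u3 u1 u2 |
        split_span A r u2 u1 u3 /\ split_span A r u3 u1 u2] }.

Lemma junction_swap A u1 u2 u3 : junction A u1 u2 u3 -> junction A u2 u1 u3.
Proof.
case=> s12 s13 s23 p1 p2 p3 inner; split=> //; first exact: span_sym.
  exact: split_span_sym.
move=> r rA r2 r1 r3; case: (inner r rA r1 r2 r3) => -[h h'].
- by apply: Or31.
- by apply: Or33; split=> //; apply: split_span_sym.
- by apply: Or32; split=> //; apply: split_span_sym.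
Qed.

Lemma junction_triangle u1 u2 u3 :
  oadj u1 u2 -> oadj u1 u3 -> oadj u2 u3 -> junction [:: u1; u2; u3] u1 u2 u3.
Proof.
move=> u12 u13 u23; have [u21 u31 u32] :
  [/\ oadj u2 u1, oadj u3 u1 & oadj u3 u2] by split; rewrite oadj_sym.
split.
- by exists [:: u3; u2]; split=> //=; [perm_count | rewrite u13 u32].
- by exists [:: u2; u3]; split=> //=; rewrite u12 u23.
- by exists [:: u1; u3]; split=> //=; [perm_count | rewrite u21 u13].
- exists [:: u1], [:: u2; u3]; split=> //; first exact: span1.
  by exists [:: u3]; split=> //=; rewrite u23.
- exists [:: u2], [:: u1; u3]; split=> //; [perm_count | exact: span1 |].
  by exists [:: u3]; split=> //=; rewrite u13.
- exists [:: u3], [:: u1; u2]; split=> //; [perm_count | exact: span1 |].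
  by exists [:: u2]; split=> //=; rewrite u12.
by move=> r; rewrite !inE => /or3P[] /eqP->; rewrite eqxx.
Qed.

Lemma junction_split23 A u1 u2 u3 r : junction A u1 u2 u3 -> r \in A ->
  r != u1 -> split_span A r u2 u1 u3 \/ split_span A r u3 u1 u2.
Proof.
move=> J rA r1; case: (altP (r =P u2)) => [->|r2]; first by left; case: J.
case: (altP (r =P u3)) => [->|r3]; first by right; case: J.
by case: (split_inner J rA r1 r2 r3) => -[h h']; [left | right | left].
Qed.

Lemma junction_grow A u1 u2 u3 v r : junction A u1 u2 u3 ->
  oadj u1 v -> r \in A -> r != u1 -> oadj v r -> junction (v :: A) v u2 u3.
Proof.
move=> J uv rA r1 vr; have J23 := junction_split23 J rA r1.
case: (J) => s12 s13 s23 p1 p2 p3 inner; split.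
- exact: span_cons s12.
- exact: span_cons s13.
- case: J23 => -[S [T [ST rs us]]].
    apply: (@span_perm (S ++ v :: T)); first by perm_count.
    apply: span_cat (span_sym rs) _ (span_cons uv us); by rewrite oadj_sym.
  apply: (@span_perm (S ++ v :: T)); first by perm_count.
  apply: span_sym; apply: span_cat (span_sym rs) _ (span_cons uv us).
  by rewrite oadj_sym.
- by exists [:: v], A; split=> //; apply: span1.
- exact: split_span_grow_r p2.
- exact: split_span_grow_r p3.
move=> q; rewrite inE => /orP[/eqP->|qA]; first by rewrite eqxx.
move=> _ q2 q3; case: (altP (q =P u1)) => [->|q1].
  have q1v := split_span_grow_l uv p1.
  case: J23 => -[S [T [ST rs us]]]; [apply: Or32 | apply: Or31]; split=> //;
    exists T, (v :: S); (split=> //; first by perm_count);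
    by apply: span_cons rs; rewrite oadj_sym.
case: (inner q qA q1 q2 q3) => -[h h'].
- apply: Or31; split; [exact: split_span_grow_l h | exact: split_span_grow_r h'].
- apply: Or32; split; [exact: split_span_grow_l h | exact: split_span_grow_r h'].
- apply: Or33; split; [exact: split_span_grow_r h | exact: split_span_grow_r h'].
Qed.

Lemma junction_grow2 A u1 u2 u3 v1 v2 : junction A u1 u2 u3 ->
  oadj u1 v1 -> oadj u2 v2 -> oadj v1 v2 -> junction (v1 :: v2 :: A) v1 v2 u3.
Proof.
move=> J uv1 uv2 v12; have v21 : oadj v2 v1 by rewrite oadj_sym.
case: (J) => s12 s13 s23 p1 p2 p3 inner.
have grow_l q : split_span A q u1 u2 u3 -> split_span [:: v1, v2 & A] q v1 v2 u3.
  by move=> h; apply: split_span_grow_l uv1 _; apply: split_span_grow_r uv2 h.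
have perm12 x y z w : split_span [:: v2, v1 & A] x y z w ->
    split_span [:: v1, v2 & A] x y z w.
  by case=> S [T [ST xy zw]]; exists S, T; split=> //; perm_count.
have grow_r q : split_span A q u2 u1 u3 -> split_span [:: v1, v2 & A] q v2 v1 u3.
  by move=> h; apply: split_span_grow_r uv1 _; apply: split_span_grow_l uv2 h.
have grow_3 q : split_span A q u3 u1 u2 -> split_span [:: v1, v2 & A] q u3 v1 v2.
  move=> h; apply: split_span_grow_r uv1 _; apply: split_span_sym.
  by apply: split_span_grow_r uv2 _; apply: split_span_sym.
have pair : span [:: v1; v2] v1 v2.
  by exists [:: v2]; split=> //=; rewrite v12.
split.
- apply: span_cons uv1 _; exact: span_rcons uv2 s12.
- apply: span_cons v21 _; exact: span_cons uv2 s23.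
- apply: (@span_perm [:: v2, v1 & A]); first by perm_count.
  apply: span_cons v12 _; exact: span_cons uv1 s13.
- exists [:: v1], (v2 :: A); split=> //; first exact: span1.
  exact: span_cons uv2 s23.
- exists [:: v2], (v1 :: A); split=> //; [by perm_count | exact: span1 |].
  exact: span_cons uv1 s13.
- exact: grow_3.
move=> q; rewrite !inE => /or3P[/eqP->|/eqP->|qA]; rewrite ?eqxx // => _ _ q3.
have far x y : span A x y -> split_span [:: v1, v2 & A] x y v1 v2.
  by move=> h; exists A, [:: v1; v2]; split=> //; perm_count.
case: (altP (q =P u1)) => [->|q1]; first by apply: Or32; split; auto.
case: (altP (q =P u2)) => [->|q2]; first by apply: Or33; split; auto.
case: (inner q qA q1 q2 q3) => -[h h'].
- by apply: Or31; split; auto.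
- by apply: Or32; split; auto.
- by apply: Or33; split; auto.
Qed.

End Spans.

Lemma leq_add_pairs n i j k l :
  n <= i + j -> n <= k + l -> n <= i + k \/ n <= j + l.
Proof. by case: (leqP n (i + k)); [left | right; lia]. Qed.

Section Links.
Variable G : sgraph.
Implicit Types (a b x y z u v w r s : G) (A B C D I J Q S T : seq G).

Definition link u I w := path (@oadj G) u (rcons I w).

Lemma link_adj u I w : path (@adj G) u (rcons I w) -> link u I w.
Proof. by apply: sub_path => x y; apply: adj_oadj. Qed.

Lemma link_sym u I w : link u I w -> link w (rev I) u.
Proof.
by rewrite /link -oadj_path_rev last_rcons belast_rcons rev_cons.
Qed.

Lemma link_ends u v p w : link u (v :: p) w ->
  [/\ oadj u v, span (v :: p) v (last v p) & oadj (last v p) w].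
Proof.
by rewrite /link /= rcons_path => /and3P[uv pp pw]; split=> //; apply: span_path.
Qed.

Lemma span_link S I T x u w y :
  span S x u -> link u I w -> span T w y -> span (S ++ I ++ T) x y.
Proof.
case: I => [|v p] Sxu; first by rewrite /link /= andbT; apply: span_cat.
by case/link_ends=> uv vp pw Twy; apply: span_cat uv (span_cat vp pw Twy).
Qed.

Lemma span_mem S x y : span S x y -> x \in S /\ y \in S.
Proof.
case=> p [ps _ <-]; rewrite -!(perm_mem ps).
by split; [exact: mem_head | exact: mem_last].
Qed.

Lemma split_span_cycle A B r s u1 u2 u3 w1 w2 w3 I1 I2 I3 :
  split_span A r u1 u3 u2 -> split_span B s w2 w1 w3 ->
  link u1 I1 w1 -> link u2 I2 w2 -> link u3 I3 w3 -> oadj r s ->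
  exists2 c, perm_eq c (A ++ B ++ I1 ++ I2 ++ I3) & cycle (@oadj G) c.
Proof.
case=> S [T [ST ru uu]] [S' [T' [ST' sw ww]]] l1 l2 l3 rs.
have rs_span := span_link ru l1 (span_link ww (link_sym l3)
  (span_link uu l2 (span_sym sw))).
have [c cs cc] := span_cycle rs_span rs; exists c => //; perm_count.
Qed.

Variable C : seq G.
Hypothesis C_uniq : uniq C.
Hypothesis C_max :
  forall t, ucycle (@oadj G) t -> {subset C <= t} -> size t <= size C.

Definition off Q := [&& Q != [::], uniq Q & ~~ has (mem C) Q].

Lemma no_larger_cycle c Q :
  off Q -> perm_eq c (C ++ Q) -> ~ cycle (@oadj G) c.
Proof.
case/and3P=> Q0 uQ CQ cCQ cc.
have uc : uniq c by rewrite (perm_uniq cCQ) cat_uniq C_uniq CQ uQ.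
have sub : {subset C <= c} by move=> z zC; rewrite (perm_mem cCQ) mem_cat zC.
have := C_max (introT andP (conj cc uc)) sub.
by rewrite (perm_size cCQ) size_cat; case: Q Q0 {uQ CQ cCQ} => //= *; lia.
Qed.

Lemma no_detour D Q a b x y : perm_eq D C -> span D a b ->
  off Q -> span Q x y -> oadj a x -> oadj b y -> False.
Proof.
move=> DC Dab offQ Qxy ax yb.
have [c cD cc] := span_cycle (span_cat Dab yb (span_sym Qxy)) ax.
by apply: no_larger_cycle cc; [exact: offQ | perm_count].
Qed.

(* The cycle [C] runs [a], through [A] to [u1], along [I1] to [w1], through [B],
   and back along [I2] from [w2] to [u2]; the third path from [a] to [b], off [C],
   is kept separate. *)
Record theta a b A B u1 u2 w1 w2 I1 I2 : Prop := Theta {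
  theta_l : junction A u1 u2 a;
  theta_r : junction B w1 w2 b;
  theta_l_uniq : uniq [:: u1; u2; a];
  theta_r_uniq : uniq [:: w1; w2; b];
  theta_1 : path (@adj G) u1 (rcons I1 w1);
  theta_2 : path (@adj G) u2 (rcons I2 w2);
  theta_perm : perm_eq (A ++ B ++ I1 ++ I2) C }.

Lemma adj_path_rev x p :
  path (@adj G) (last x p) (rev (belast x p)) = path (@adj G) x p.
Proof. by rewrite rev_path; apply: eq_path => y z; apply: adj_sym. Qed.

Lemma theta_swap a b A B u1 u2 w1 w2 I1 I2 :
  theta a b A B u1 u2 w1 w2 I1 I2 -> theta a b A B u2 u1 w2 w1 I2 I1.
Proof.
case=> JA JB uA uB l1 l2 eqC; split;
  [exact: junction_swap|exact: junction_swap| | |exact: l2|exact: l1|perm_count].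
- by rewrite (perm_uniq (_ : perm_eq _ [:: u1; u2; a])) //; perm_count.
- by rewrite (perm_uniq (_ : perm_eq _ [:: w1; w2; b])) //; perm_count.
Qed.

Lemma theta_rev a b A B u1 u2 w1 w2 I1 I2 :
  theta a b A B u1 u2 w1 w2 I1 I2 ->
  theta b a B A w1 w2 u1 u2 (rev I1) (rev I2).
Proof.
case=> JA JB uA uB l1 l2 eqC; split; [exact: JB|exact: JA|exact: uB|exact: uA| | |perm_count].
- by rewrite -adj_path_rev last_rcons belast_rcons rev_cons revK.
- by rewrite -adj_path_rev last_rcons belast_rcons rev_cons revK.
Qed.

Section Detour.
Variables (a b x y : G) (Q : seq G).
Hypotheses (offQ : off Q) (spanQ : span Q x y) (ax : oadj a x) (by_ : oadj b y).

Lemma theta_nonempty A B u1 u2 w1 w2 I2 :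
  ~ theta a b A B u1 u2 w1 w2 [::] I2.
Proof.
case=> JA JB _ _ _ /link_adj l2 eqC.
have sp := span_link (span_sym (span23 JA)) l2 (span23 JB).
by apply: no_detour sp offQ spanQ ax by_; perm_count.
Qed.

End Detour.

Definition saturated A u1 u2 I1 I2 :=
  forall v1 J1 v2 J2, I1 = v1 :: J1 -> I2 = v2 :: J2 ->
  [/\ forall r, r \in A -> r != u1 -> ~~ oadj v1 r,
      forall r, r \in A -> r != u2 -> ~~ oadj v2 r & ~~ oadj v1 v2].

Lemma theta_grow1 a b A B u1 u2 w1 w2 v1 J1 I2 r :
  theta a b A B u1 u2 w1 w2 (v1 :: J1) I2 ->
  r \in A -> r != u1 -> oadj v1 r ->
  theta a b (v1 :: A) B v1 u2 w1 w2 J1 I2.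
Proof.
case=> JA JB uA uB /= /andP[uv l1] l2 eqC rA ru vr.
have uAll : uniq (A ++ B ++ (v1 :: J1) ++ I2) by rewrite (perm_uniq eqC).
have vA : v1 \notin A.
  apply/negP => vA; move: uAll; rewrite cat_uniq => /and3P[_ /hasP[]].
  by exists v1; rewrite // !mem_cat mem_head orbT.
have [u2A aA] := span_mem (span23 JA).
split; [|exact: JB| |exact: uB|exact: l1|exact: l2|perm_count].
- exact: junction_grow JA (adj_oadj uv) rA ru vr.
- rewrite cons_uniq; move: uA => /= /andP[_ ->]; rewrite !inE negb_or !andbT.
  by apply/andP; split; apply: contra vA => /eqP->.
Qed.

Lemma theta_grow2 a b A B u1 u2 w1 w2 v1 J1 v2 J2 :
  theta a b A B u1 u2 w1 w2 (v1 :: J1) (v2 :: J2) -> oadj v1 v2 ->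
  theta a b [:: v1, v2 & A] B v1 v2 w1 w2 J1 J2.
Proof.
case=> JA JB uA uB /= /andP[uv1 l1] /andP[uv2 l2] eqC v12.
have uAll : uniq (A ++ B ++ (v1 :: J1) ++ v2 :: J2) by rewrite (perm_uniq eqC).
have vA v : (v == v1) || (v == v2) -> v \notin A.
  move=> vE; apply/negP => vA; move: uAll; rewrite cat_uniq => /and3P[_ /hasP[]].
  by exists v; rewrite // !mem_cat !inE; case/orP: vE => ->; rewrite !orbT.
have [_ aA] := span_mem (span23 JA).
split; [|exact: JB| |exact: uB|exact: l1|exact: l2|perm_count].
- exact: junction_grow2 JA (adj_oadj uv1) (adj_oadj uv2) v12.
- rewrite /= !inE !negb_or andbT; case/andP: v12 => -> _ /=.
  by apply/andP; split; [move: (vA v1) | move: (vA v2)]; rewrite eqxx ?orbT => /(_ isT);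
     apply: contra => /eqP->.
Qed.

Lemma theta_saturate_l a b A B u1 u2 w1 w2 I1 I2 :
  theta a b A B u1 u2 w1 w2 I1 I2 ->
  saturated A u1 u2 I1 I2 \/
  exists A' u1' u2' I1' I2', size A < size A' /\
    theta a b A' B u1' u2' w1 w2 I1' I2'.
Proof.
case: I1 => [|v1 J1]; first by left.
case: I2 => [|v2 J2] th; first by left.
case: (boolP (has (fun r => (r != u1) && oadj v1 r) A)) => [/hasP[r rA /andP[ru vr]]|h1].
  right; exists (v1 :: A), v1, u2, J1, (v2 :: J2); split=> //.
  exact: theta_grow1 th rA ru vr.
case: (boolP (has (fun r => (r != u2) && oadj v2 r) A)) => [/hasP[r rA /andP[ru vr]]|h2].
  right; exists (v2 :: A), u1, v2, (v1 :: J1), J2; split=> //.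
  by apply: theta_swap; apply: theta_grow1 (theta_swap th) rA ru vr.
case: (boolP (oadj v1 v2)) => [v12|v12].
  right; exists [:: v1, v2 & A], v1, v2, J1, J2; split; first by rewrite /= ltnS.
  exact: theta_grow2 th v12.
left=> _ _ _ _ [<- _] [<- _]; split=> // r rA ru.
- by apply: contra h1 => vr; apply/hasP; exists r; rewrite ?ru.
- by apply: contra h2 => vr; apply/hasP; exists r; rewrite ?ru.
Qed.

Lemma theta_saturate a b A B u1 u2 w1 w2 I1 I2 :
  theta a b A B u1 u2 w1 w2 I1 I2 ->
  exists A' B' u1' u2' w1' w2' I1' I2',
    [/\ theta a b A' B' u1' u2' w1' w2' I1' I2', saturated A' u1' u2' I1' I2' &
        saturated B' w1' w2' (rev I1') (rev I2')].
Proof.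
have [n] := ubnP (size C - (size A + size B)).
elim: n A B u1 u2 w1 w2 I1 I2 => // n IHn A B u1 u2 w1 w2 I1 I2 lt_n th.
have sz A' B' u1' u2' w1' w2' I1' I2' :
    theta a b A' B' u1' u2' w1' w2' I1' I2' -> size A' + size B' <= size C.
  case=> _ _ _ _ _ _ /perm_size <-.
  by rewrite !size_cat addnA leq_addr.
have [satA|[A' [u1' [u2' [I1' [I2' [szA th']]]]]]] := theta_saturate_l th; last first.
  by apply: IHn (th'); move: (sz _ _ _ _ _ _ _ _ th') lt_n szA; clear; lia.
have [satB|[B' [w1' [w2' [I1' [I2' [szB th']]]]]]] :=
    theta_saturate_l (theta_rev th); last first.
  have {}th' := theta_rev th'.
  by apply: IHn (th'); move: (sz _ _ _ _ _ _ _ _ th') lt_n szB; clear; lia.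
by exists A, B, u1, u2, w1, w2, I1, I2.
Qed.

Lemma junction_split12 A u1 u2 u3 r : junction A u1 u2 u3 -> r \in A ->
  r != u3 -> split_span A r u1 u2 u3 \/ split_span A r u2 u1 u3.
Proof.
move=> J rA r3; case: (altP (r =P u1)) => [->|r1]; first by left; case: J.
case: (altP (r =P u2)) => [->|r2]; first by right; case: J.
by case: (split_inner J rA r1 r2 r3) => -[h h']; [left | left | right].
Qed.

Lemma junction_cases A u1 u2 u3 r : junction A u1 u2 u3 -> r \in A ->
  (r = u1 /\ split_span A r u1 u2 u3) \/ (r = u2 /\ split_span A r u2 u1 u3) \/
  (r = u3 /\ split_span A r u3 u1 u2) \/
  (split_span A r u1 u2 u3 /\ split_span A r u2 u1 u3) \/
  (split_span A r u1 u2 u3 /\ split_span A r u3 u1 u2) \/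
  (split_span A r u2 u1 u3 /\ split_span A r u3 u1 u2).
Proof.
move=> J rA; case: (altP (r =P u1)) => [->|r1]; first by left; case: J.
case: (altP (r =P u2)) => [->|r2]; first by right; left; case: J.
case: (altP (r =P u3)) => [->|r3]; first by do 2 right; left; case: J.
by case: (split_inner J rA r1 r2 r3); tauto.
Qed.

Definition real_on A := forall r s, r \in A -> s \in A -> oadj r s -> adj r s.

Section ThetaFacts.
Variables (a b u1 u2 w1 w2 : G) (A B I1 I2 : seq G).
Hypothesis th : theta a b A B u1 u2 w1 w2 I1 I2.

Let JA := theta_l th.
Let JB := theta_r th.
Let l1 := link_adj (theta_1 th).
Let l2 := link_adj (theta_2 th).
Let eqC := theta_perm th.

Lemma theta_uniq : uniq (A ++ B ++ I1 ++ I2).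
Proof. by rewrite (perm_uniq eqC). Qed.

Lemma theta_mem z :
  (z \in C) = [|| z \in A, z \in B, z \in I1 | z \in I2].
Proof. by rewrite -(perm_mem eqC) !mem_cat. Qed.

Lemma theta_disjoint r s : r \in A -> s \in B -> r != s.
Proof.
move=> rA sB; apply/eqP => E; move: theta_uniq; rewrite cat_uniq.
by case/and3P=> _ /hasP[]; exists r; rewrite // E mem_cat sB.
Qed.

Lemma theta_cross Q r s : off Q -> link a Q b -> r \in A -> s \in B ->
  oadj r s -> (r = u1 /\ s = w1) \/ (r = u2 /\ s = w2) \/ (r = a /\ s = b).
Proof.
move=> offQ lQ rA sB rs.
have none X : perm_eq X (I1 ++ I2 ++ Q) ->
    (exists2 c, perm_eq c (A ++ B ++ X) & cycle (@oadj G) c) -> False.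
  move=> eqX [c cX cc]; apply: (no_larger_cycle offQ _ cc); move: eqC eqX cX.
  by move=> h h' h''; perm_count.
have k12 : split_span A r u1 u2 a -> split_span B s w2 w1 b -> False.
  move=> h h'; apply: none (split_span_cycle (split_span_sym h) h' l1 l2 lQ rs).
  by perm_count.
have k21 : split_span A r u2 u1 a -> split_span B s w1 w2 b -> False.
  move=> h h'; apply: none (split_span_cycle (split_span_sym h) h' l2 l1 lQ rs).
  by perm_count.
have k13 : split_span A r u1 u2 a -> split_span B s b w1 w2 -> False.
  move=> h h'; apply: none (split_span_cycle h h' l1 lQ l2 rs).
  by perm_count.
have k31 : split_span A r a u1 u2 -> split_span B s w1 w2 b -> False.
  move=> h h'; apply: none (split_span_cycle (split_span_sym h)
    (split_span_sym h') lQ l1 l2 rs).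
  by perm_count.
have k23 : split_span A r u2 u1 a -> split_span B s b w1 w2 -> False.
  move=> h h'; apply: none (split_span_cycle h (split_span_sym h') l2 lQ l1 rs).
  by perm_count.
have k32 : split_span A r a u1 u2 -> split_span B s w2 w1 b -> False.
  move=> h h'; apply: none (split_span_cycle h (split_span_sym h') lQ l2 l1 rs).
  by perm_count.
move: (junction_cases JA rA) (junction_cases JB sB) k12 k21 k13 k31 k23 k32.
by clear; tauto.
Qed.

Lemma theta_real Q : off Q -> link a Q b -> real_on A \/ real_on B.
Proof.
move=> offQ lQ.
pose blue D := has (fun r => has (fun s => oadj r s && ~~ adj r s) D) D.
have realP D : ~~ blue D -> real_on D.
  move=> /hasPn nb r s rD sD rs; move/(_ r rD)/hasPn/(_ s sD): nb.
  by rewrite rs negbK.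
case: (boolP (blue A)) => [|/realP]; last by left.
case: (boolP (blue B)) => [|/realP]; last by right.
case/hasP=> s1 s1B /hasP[s2 s2B /andP[/andP[s12 ds] ns]].
case/hasP=> r1 r1A /hasP[r2 r2A /andP[/andP[r12 dr] nr]].
rewrite (negbTE ns) in ds; rewrite (negbTE nr) in dr; exfalso.
have cross r s : r \in A -> s \in B -> #|G| <= degree r + degree s ->
    (r = u1 /\ s = w1) \/ (r = u2 /\ s = w2) \/ (r = a /\ s = b).
  move=> rA sB rs; apply: (theta_cross offQ lQ rA sB).
  by apply/andP; split; [apply: theta_disjoint | apply/orP; right].
have pair1 : #|G| <= degree r1 + degree s1 \/ #|G| <= degree r2 + degree s2.
  exact: leq_add_pairs.
have pair2 : #|G| <= degree r1 + degree s2 \/ #|G| <= degree r2 + degree s1.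
  by apply: leq_add_pairs; rewrite // addnC.
move: (theta_l_uniq th) (theta_r_uniq th); rewrite /= !inE !negb_or !andbT.
case/andP=> /andP[/eqP u12 /eqP u1a] /eqP u2a.
case/andP=> /andP[/eqP w12 /eqP w1b] /eqP w2b.
move/eqP: r12 => r12; move/eqP: s12 => s12.
case: pair1 pair2 => d1 [] d2;
  [move: (cross _ _ r1A s1B d1) (cross _ _ r1A s2B d2) |
   move: (cross _ _ r1A s1B d1) (cross _ _ r2A s1B d2) |
   move: (cross _ _ r2A s2B d1) (cross _ _ r1A s2B d2) |
   move: (cross _ _ r2A s2B d1) (cross _ _ r2A s1B d2)];
  by clear - u12 u1a u2a w12 w1b w2b r12 s12; intuition congruence.
Qed.

End ThetaFacts.

Lemma off_path_apart a b A B u1 u2 w1 w2 I1 I2 Q x y r :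
  theta a b A B u1 u2 w1 w2 I1 I2 -> off Q -> span Q x y -> oadj a x ->
  r \in A -> r != a -> ~~ oadj y r.
Proof.
move=> th offQ Qxy ax rA ra; apply/negP => yr.
wlog [S [T [ST ru uu]]] : u1 u2 w1 w2 I1 I2 th / split_span A r u1 u2 a.
  move=> W; case: (junction_split12 (theta_l th) rA ra) => h; first exact: W th h.
  exact: W (theta_swap th) h.
case: (th) => JA JB _ _ /link_adj l1 /link_adj l2 eqC.
have sp := span_link (span_sym uu) l2 (span_link (span_sym (span12 JB)) (link_sym l1)
  (span_sym ru)).
by apply: no_detour sp offQ Qxy ax _; [perm_count | rewrite oadj_sym].
Qed.

Lemma off_path_apart_next a b A B u1 u2 w1 w2 v1 J1 I2 Q x y :
  theta a b A B u1 u2 w1 w2 (v1 :: J1) I2 -> off Q -> span Q x y -> oadj a x ->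
  ~~ oadj y v1.
Proof.
move=> th offQ Qxy ax; apply/negP => yv.
case: (th) => JA JB _ _ /link_adj l1 /link_adj l2 eqC.
have [_ sp1 l1'] := link_ends l1.
have sp := span_link (span_sym (span23 JA)) l2
  (span_cat (span_sym (span12 JB)) (_ : oadj w1 (last v1 J1)) (span_sym sp1)).
apply: no_detour (sp _) offQ Qxy ax _; rewrite 1?oadj_sym //.
by perm_count.
Qed.

Lemma far_end_apart_next a b A B u1 u2 w1 w2 v1 J1 I2 Q :
  theta a b A B u1 u2 w1 w2 (v1 :: J1) I2 -> off Q -> link a Q b -> ~~ oadj v1 b.
Proof.
move=> th offQ lQ; apply/negP => vb.
case: (th) => JA JB _ _ /link_adj l1 /link_adj l2 eqC.
have [_ sp1 l1'] := link_ends l1.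
have [S [T [ST bb ww]]] := split3 JB.
have sp := span_cat sp1 l1' (span_link ww (link_sym l2)
  (span_link (span23 JA) lQ bb)).
have [c cs cc] := span_cycle sp vb.
by apply: (no_larger_cycle offQ _ cc); perm_count.
Qed.

End Links.

Section InducedPaths.
Variable G : sgraph.
Implicit Types (x y z t : G) (p q r : seq G).

Fixpoint induced_path x p :=
  if p is y :: q then [&& adj x y, all (apart x) q & induced_path y q] else true.

Lemma induced_path_of_path (D : {pred G}) x p :
  {in D &, forall y z, y != z -> ~~ adj y z -> apart y z} ->
  path (@adj G) x p -> uniq (x :: p) -> {subset x :: p <= D} ->
  exists q, [/\ induced_path x q, last x q = last x p, uniq (x :: q)
              & {subset q <= p}].
Proof.
move=> realD; have [n] := ubnP (size p).
elim: n x p => // n IHn x [_ _ _ _|y p lt_n /= /andP[xy pp]]; first by exists [::].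
case/andP=> xp up sD.
have [p1 [z [p2 [Ep xz nx2]]]] : exists p1 z p2,
    [/\ y :: p = p1 ++ z :: p2, adj x z & ~~ has (adj x) p2].
  have: has (adj x) (y :: p) by rewrite /= xy.
  elim: (y :: p) => // t s IHs; case: (boolP (has (adj x) s)) => [/IHs|nh].
    by case=> p1 [z [p2 [-> xz nh]]] _; exists (t :: p1), z, p2.
  by rewrite /= (negbTE nh) orbF => xt; exists [::], t, s.
have pz : path (@adj G) z p2.
  have: path (@adj G) x (y :: p) by rewrite /= xy.
  by rewrite Ep cat_path /= => /and3P[].
have uz : uniq (z :: p2).
  have: uniq (y :: p) by [].
  by rewrite Ep cat_uniq => /and3P[].
have sub : {subset z :: p2 <= y :: p} by move=> t tz; rewrite Ep mem_cat tz orbT.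
have [|t tz|q [iq lq uq sq]] := IHn z p2 _ pz uz.
- have: size (y :: p) < n.+1 by [].
  by rewrite Ep size_cat /=; lia.
- by apply: sD; rewrite inE sub ?orbT.
have sq' : {subset z :: q <= y :: p}.
  by move=> t; rewrite inE => /orP[/eqP->|/sq tp]; apply: sub; rewrite inE ?eqxx ?tp ?orbT.
have xq : x \notin z :: q by apply: contra xp => /sq'.
exists (z :: q); split.
- rewrite /= xz iq andbT; apply/allP => t tq; apply: realD.
  + by apply: sD; rewrite mem_head.
  + by apply: sD; rewrite inE sq' ?orbT // inE tq orbT.
  + by apply: contraNneq xq => ->; rewrite inE tq orbT.
  + by apply: contra nx2 => xt; apply/hasP; exists t => //; apply: sq.
- rewrite /= lq; have: last x (y :: p) = last x (y :: p) by [].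
  by rewrite {1}Ep last_cat.
- by rewrite cons_uniq xq.
- exact: sq'.
Qed.

Lemma induced_path_rcons x p y : induced_path x p -> adj (last x p) y ->
  {in belast x p, forall z, apart z y} -> induced_path x (rcons p y).
Proof.
elim: p x => [|z p IHp] x /=; first by move=> _ ->.
case/and3P=> -> xp ip ly apy; rewrite all_rcons xp apy ?mem_head //=.
by apply: IHp => // t tp; apply: apy; rewrite inE tp orbT.
Qed.

Lemma induced_path_adj x p i : induced_path x p -> i < size p ->
  adj (nth x (x :: p) i) (nth x (x :: p) i.+1).
Proof.
elim: p x i => // y p IHp x [|i] /= /and3P[xy _ ip] //.
move=> lt_i; have := IHp y i ip lt_i.
by rewrite /= !(set_nth_default y x) //= ltnW.
Qed.

Lemma induced_path_apart x p i j : induced_path x p -> i.+1 < j -> j <= size p ->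
  apart (nth x (x :: p) i) (nth x (x :: p) j).
Proof.
elim: p x i j => [|y p IHp] x i [|j] //= /and3P[xy xp ip] //.
case: i => [|i]; rewrite ltnS => lt_ij le_j.
  by case: j lt_ij le_j => // j _ le_j; apply: (allP xp); rewrite /= mem_nth.
have := IHp y i j ip lt_ij le_j.
by rewrite /= !(set_nth_default y x) //=; move: lt_ij le_j; clear; lia.
Qed.

Lemma induced_path_suffix x p q :
  induced_path x (p ++ q) -> induced_path (last x p) q.
Proof. by elim: p x => //= y p IHp x /and3P[_ _ /IHp]. Qed.

Lemma induced_path_first_hit (P : pred G) x y r :
  induced_path x (y :: r) -> ~~ P x -> ~~ P y -> has P r ->
  exists t' t z, [/\ adj t t', adj z t, apart z t' &
    [/\ ~~ P t', ~~ P t, P z & {subset [:: t'; t; z] <= x :: y :: r}]].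
Proof.
elim: r x y => // z r IHr x y /= /and3P[xy /andP[xz xr] /and3P[yz yr ir]] nPx nPy.
case: (boolP (P z)) => [Pz _|nPz] /=.
  exists x, y, z; split=> //; [by rewrite adj_sym|by rewrite adj_sym|by rewrite apart_sym|].
  by split=> // t; rewrite !inE => /or3P[]/eqP->; rewrite eqxx ?orbT.
move=> Pr; have [|t' [t [w [h1 h2 h3 [h4 h5 h6 sub]]]]] := IHr y z _ nPy nPz Pr.
  by rewrite /= yz yr ir.
exists t', t, w; split=> //; split=> // s /sub; rewrite !inE => ->.
by rewrite orbT.
Qed.

End InducedPaths.

Section ThetaEnd.
Variable G : sgraph.
Variable C : seq G.
Hypothesis C_uniq : uniq C.
Hypothesis C_max :
  forall t, ucycle (@oadj G) t -> {subset C <= t} -> size t <= size C.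
Hypothesis clawG : H_heavy claw G.
Hypothesis N112G : H_heavy N112 G.
Variables (a b u1 u2 w1 w2 v1 v2 : G) (A B J1 J2 : seq G).
Hypothesis th : theta C a b A B u1 u2 w1 w2 (v1 :: J1) (v2 :: J2).
Hypothesis satA : saturated A u1 u2 (v1 :: J1) (v2 :: J2).
Hypothesis realA : real_on A.

Lemma theta_end_mem : [/\ u1 \in A, u2 \in A & a \in A].
Proof.
by have [? ?] := span_mem (span12 (theta_l th));
   have [? ?] := span_mem (span13 (theta_l th)).
Qed.

Lemma theta_end_neq : [/\ u1 != u2, u1 != a & u2 != a].
Proof.
have := theta_l_uniq th; rewrite /= !inE !negb_or !andbT.
by case/andP=> /andP[].
Qed.

Lemma theta_next_adj : adj u1 v1 /\ adj u2 v2.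
Proof.
by have /andP[] := theta_1 th; have /andP[] := theta_2 th.
Qed.

Lemma theta_next_neq : [/\ v1 \notin A, v2 \notin A & v1 != v2].
Proof.
have := theta_uniq C_uniq th; rewrite cat_uniq => /and3P[_ /hasPn nA].
rewrite cat_uniq => /and3P[_ _]; rewrite cat_uniq => /and3P[_ /hasPn n1 _].
have nvA v : v \in v1 :: J1 ++ v2 :: J2 -> v \notin A.
  by move=> vJ; apply: nA; rewrite mem_cat vJ orbT.
split; [apply: nvA | apply: nvA |].
- by rewrite mem_head.
- by rewrite inE mem_cat mem_head !orbT.
- by have := n1 v2 (mem_head _ _); rewrite inE negb_or eq_sym => /andP[].
Qed.

Lemma theta_next_apart1 r : r \in A -> r != u1 -> apart v1 r.
Proof.
move=> rA ru; have [/(_ r rA ru) vr _ _] := satA (erefl _) (erefl _).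
have [v1A _ _] := theta_next_neq; rewrite /apart /= vr andbT.
by apply: contraNneq v1A => ->.
Qed.

Lemma theta_next_apart2 r : r \in A -> r != u2 -> apart v2 r.
Proof.
move=> rA ru; have [_ /(_ r rA ru) vr _] := satA (erefl _) (erefl _).
have [_ v2A _] := theta_next_neq; rewrite /apart /= vr andbT.
by apply: contraNneq v2A => ->.
Qed.

Lemma theta_next_apart12 : apart v1 v2.
Proof.
have [_ _ v12] := satA (erefl _) (erefl _).
by have [_ _ v1v2] := theta_next_neq; rewrite /apart /= v12 v1v2.
Qed.

Lemma real_on_apart : {in A &, forall r s, r != s -> ~~ adj r s -> apart r s}.
Proof.
move=> r s rA sA rs nrs; rewrite /apart /= rs /=.
by apply: contra nrs; apply: realA.
Qed.

Lemma path_in_junction x y : span A x y ->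
  exists p, [/\ induced_path x p, last x p = y, uniq (x :: p) & {subset x :: p <= A}].
Proof.
case=> p [pA pp lp].
have uA : uniq A by move: (theta_uniq C_uniq th); rewrite cat_uniq => /andP[].
have sA : {subset x :: p <= A} by move=> z; rewrite (perm_mem pA).
have pr : path (@adj G) x p.
  by apply: (sub_in_path (P := mem A)) pp; [move=> r s; exact: realA | exact/allP].
have [|q [iq lq uq sq]] := induced_path_of_path real_on_apart pr _ sA.
  by rewrite (perm_uniq pA).
exists q; split=> //; first by rewrite lq.
by move=> z; rewrite inE => zq; apply: sA; rewrite inE; case/orP: zq => [->//|/sq ->];
   rewrite orbT.
Qed.

Lemma theta_off_mem z : z \notin C ->
  [/\ z \notin A, z \notin B, z != v1 & z != v2].
Proof.
rewrite (theta_mem th) !inE !negb_or => /and4P[-> -> /andP[-> _] /andP[-> _]].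
by [].
Qed.

Lemma off_tail_apart y z q :
  path (@adj G) y q -> uniq (y :: q) -> ~~ has (mem C) (y :: q) ->
  adj a y -> z = last y q ->
  (forall r, r \in A -> r != a -> apart z r) /\ (apart z v1 /\ apart z v2).
Proof.
move=> pq uq nC ay Ez.
have zC : z \notin C.
  by apply: contra nC => zC; apply/hasP; exists z => //; rewrite Ez mem_last.
have [zA _ zv1 zv2] := theta_off_mem zC.
have offQ : off C (y :: q) by rewrite /off uq nC.
have Qyz : span (y :: q) y z.
  by rewrite Ez; apply: span_path; apply: sub_path pq => s t; apply: adj_oadj.
split=> [r rA ra|].
  rewrite /apart /= (off_path_apart C_uniq C_max th offQ Qyz (adj_oadj ay)) // andbT.
  by apply: contraNneq zA => ->.
rewrite /apart /= zv1 zv2 /=; split.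
  exact: (off_path_apart_next C_uniq C_max th offQ Qyz (adj_oadj ay)).
exact: (off_path_apart_next C_uniq C_max (theta_swap th) offQ Qyz (adj_oadj ay)).
Qed.

Lemma off_neighbour_apart z : z \notin C -> adj a z ->
  (forall r, r \in A -> r != a -> apart z r) /\ (apart z v1 /\ apart z v2).
Proof.
by move=> zC az; apply: (@off_tail_apart z z [::]); rewrite //= orbF.
Qed.

(* If [z] is attached to the induced path [v1 u1 .. u2 v2], the claw condition
   yields a generalized net with leaves [v1], [v2] and [t]; it is [N_{1,1,2}]
   unless its triangle is [u1 u2 z]. *)
Lemma attached_triangle q z t :
  induced_path u1 q -> last u1 q = u2 -> uniq (u1 :: q) -> {subset u1 :: q <= A} ->
  z \in A -> z \notin u1 :: q -> has (adj z) (u1 :: q) -> adj z t ->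
  all (apart t) (v1 :: u1 :: rcons q v2) ->
  [/\ q = [:: u2], adj z u1, adj z u2 &
    forall t', adj t t' -> apart z t' -> ~~ all (apart t') (v1 :: u1 :: rcons q v2)].
Proof.
move=> iq lq uq sq zA zq hz zt tL.
set s := u1 :: rcons q v2; pose L i := nth v1 (v1 :: s) i.
have [[uv1 uv2] [u12 _ _]] := (theta_next_adj, theta_end_neq).
have s_size : size s = (size q).+2 by rewrite /= size_rcons.
have LE i : 0 < i -> i < size s -> L i \in u1 :: q.
  case: i => // i _; rewrite s_size ltnS => lt_i.
  rewrite /L /s /= -rcons_cons nth_rcons lt_i.
  by apply: mem_nth.
have Lsz : L (size s) = v2.
  by rewrite s_size /L /= nth_rcons ltnn eqxx.
have LA i : 0 < i -> i < size s -> L i \in A by move=> i0 /(LE _ i0) /sq.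
have iL : induced_path v1 s.
  rewrite /= adj_sym uv1 /=; apply/andP; split.
    rewrite all_rcons theta_next_apart12; apply/allP => r rq.
    apply: theta_next_apart1; first by apply: sq; rewrite inE rq orbT.
    by apply: contraTneq uq => <-; rewrite /= rq.
  apply: induced_path_rcons => //; first by rewrite lq.
  have ub : uniq (rcons (belast u1 q) u2) by rewrite -lq -lastI.
  move=> r rb; rewrite apart_sym; apply: theta_next_apart2.
    by apply: sq; rewrite lastI mem_rcons inE rb orbT.
  by apply: contraTneq ub => <-; rewrite rcons_uniq rb.
have Ladj i : i < size s -> adj (L i) (L i.+1) by apply: induced_path_adj.
have Lap i j : j <= size s -> i.+1 < j -> apart (L i) (L j).
  by move=> js ij; apply: induced_path_apart.
have Lap' i j : j <= size s -> i.+1 < j -> apart (L j) (L i).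
  by move=> js ij; rewrite apart_sym Lap.
have tLi i : i <= size s -> apart t (L i).
  by move=> is_; apply: (allP tL); rewrite mem_nth.
have z0 : apart z (L 0).
  rewrite apart_sym; apply: theta_next_apart1 => //.
  by apply: contraNneq zq => ->; rewrite mem_head.
have zs : apart z (L (size s)).
  rewrite Lsz apart_sym; apply: theta_next_apart2 => //.
  by apply: contraNneq zq => ->; rewrite -lq mem_last.
have zL i : i <= size s -> ~~ adj z (L i) -> apart z (L i).
  rewrite leq_eqVlt => /orP[/eqP->//|lt_i]; case: i lt_i => [//|i] lt_i nz.
  apply: real_on_apart => //; first exact: LA.
  by apply: contraNneq zq => ->; apply: LE.
have hz' : has (adj z) (v1 :: s).
  by case/hasP: hz => r rq zr; apply/hasP; exists r; rewrite // inE /s -rcons_cons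
    mem_rcons inE rq !orbT.
have := nth_find v1 hz'; have := before_find v1 (a := adj z) (s := v1 :: s).
move: (hz'); rewrite has_find ltnS.
case: (find _ _) => [_ _|k le_k before zk]; first by rewrite -[nth _ _ _]/(L 0) (apart_adjN z0).
rewrite -[nth _ _ _]/(L k.+1) in zk.
have lt_k : k.+1 < size s.
  rewrite ltn_neqAle le_k andbT; apply/eqP => E.
  by rewrite E (apart_adjN zs) in zk.
have zbefore i : i <= k -> apart z (L i).
  by move=> ik; apply: zL; [apply: leq_trans ik (ltnW (ltnW lt_k)) | rewrite [adj _ _]before].
have zk1 : adj z (L k.+2).
  apply/negPn/negP => nz; apply: (claw_heavy_oadj clawG (c := L k.+1)
    (x := z) (y := L k) (z := L k.+2)); rewrite 1?adj_sym //.
  - by rewrite Ladj // ltnW // ltnW.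
  - by rewrite adj_sym Ladj.
  - exact: zbefore.
  - exact: zL.
  - exact: Lap.
have lt_k1 : k.+2 < size s.
  rewrite ltn_neqAle lt_k andbT; apply/eqP => E.
  by rewrite E (apart_adjN zs) in zk1.
have zafter i : i <= size s -> k.+2 < i -> apart z (L i).
  move=> is_ ki; apply: zL => //; apply/negP => zi.
  apply: (claw_heavy_oadj clawG (c := z) (x := t) (y := L k.+1) (z := L i)) => //.
  - by apply: tLi; rewrite ltnW.
  - exact: tLi.
  - by apply: Lap => //; apply: ltnW.
have Ek : k = 0.
  clear le_k before; case: k zk lt_k zbefore zk1 lt_k1 zafter => // k.
  move=> zk lt_k zbefore zk1 lt_k1 zafter; exfalso.
  have le i : i <= k.+4 -> i <= size s by move=> ik; apply: leq_trans ik lt_k1.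
  apply: (N112_heavy_apart N112G (a := L k.+3) (b := z) (c := L k.+2)
    (a' := L k.+4) (b' := t) (c' := L k.+1) (c'' := L k)).
  - by rewrite adj_sym.
  - by rewrite adj_sym; apply: Ladj; apply: le; clear; lia.
  - exact: zk.
  - by apply: Ladj; apply: le; clear; lia.
  - exact: zt.
  - by rewrite adj_sym; apply: Ladj; apply: le; clear; lia.
  - by rewrite adj_sym; apply: Ladj; apply: le; clear; lia.
  - by rewrite apart_sym; apply: tLi; apply: le; clear; lia.
  - by apply: Lap'; [apply: le |]; clear; lia.
  - by apply: Lap'; [apply: le |]; clear; lia.
  - by apply: zafter; [apply: le |]; clear; lia.
  - by apply: zbefore; clear; lia.
  - by apply: zbefore; clear; lia.
  - by apply: Lap; [apply: le |]; clear; lia.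
  - by rewrite apart_sym; apply: tLi; apply: le; clear; lia.
  - by apply: Lap'; [apply: le |]; clear; lia.
  - by rewrite apart_sym; apply: tLi; apply: le; clear; lia.
  - by apply: Lap'; [apply: le |]; clear; lia.
  - by apply: Lap'; [apply: le |]; clear; lia.
  - by apply: tLi; apply: le; clear; lia.
  - by apply: tLi; apply: le; clear; lia.
subst k; clear before.
have Esz : size s = 3.
  apply/eqP; rewrite eqn_leq lt_k1 andbT leqNgt; apply/negP => lt3.
  have le i : i <= 4 -> i <= size s by move=> i4; apply: leq_trans i4 lt3.
  apply: (N112_heavy_apart N112G (a := L 1) (b := z) (c := L 2) (a' := L 0)
    (b' := t) (c' := L 3) (c'' := L 4)).
  - by rewrite adj_sym.
  - exact/Ladj/le.
  - exact: zk1.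
  - by rewrite adj_sym; apply/Ladj/le.
  - exact: zt.
  - exact/Ladj/le.
  - exact/Ladj/le.
  - by rewrite apart_sym; apply/tLi/le.
  - by apply: Lap; first exact: le.
  - by apply: Lap; first exact: le.
  - exact: zbefore.
  - by apply: zafter; first exact: le.
  - by apply: zafter; first exact: le.
  - by apply: Lap'; first exact: le.
  - by rewrite apart_sym; apply/tLi/le.
  - by apply: Lap; first exact: le.
  - by rewrite apart_sym; apply/tLi/le.
  - by apply: Lap; first exact: le.
  - by apply: Lap; first exact: le.
  - exact/tLi/le.
  - exact/tLi/le.
have Eq : q = [:: u2].
  move: lq Esz; rewrite s_size; case: (q) => [|r [|r' q']] //=; by move=> ->.
have [zu1 zu2] : adj z u1 /\ adj z u2.
  by split; [move: zk | move: zk1]; rewrite /L /s Eq.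
split=> // t' tt' zt'.
apply/negP => /allP t'L.
have t'Li i : i <= size s -> apart t' (L i).
  by move=> is_; apply: t'L; rewrite mem_nth.
have le i : i <= 3 -> i <= size s by rewrite Esz.
apply: (N112_heavy_apart N112G (a := L 1) (b := L 2) (c := z) (a' := L 0)
    (b' := L 3) (c' := t) (c'' := t')).
- exact/Ladj/le.
- by rewrite adj_sym.
- by rewrite adj_sym.
- by rewrite adj_sym; apply/Ladj/le.
- exact/Ladj/le.
- exact: zt.
- exact: tt'.
- by apply: Lap; first exact: le.
- by rewrite apart_sym; apply/tLi/le.
- by rewrite apart_sym; apply/t'Li/le.
- by apply: Lap'; first exact: le.
- by rewrite apart_sym; apply/tLi/le.
- by rewrite apart_sym; apply/t'Li/le.
- exact: zbefore.
- by apply: zafter; first exact: le.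
- exact: zt'.
- by apply: Lap; first exact: le.
- by rewrite apart_sym; apply/tLi/le.
- by rewrite apart_sym; apply/t'Li/le.
- by rewrite apart_sym; apply/tLi/le.
- by rewrite apart_sym; apply/t'Li/le.
Qed.

Lemma exits_triangle p : p \notin C -> adj a p ->
  [/\ adj u1 u2, adj a u1 & adj a u2].
Proof.
move=> pC ap; have [[u1A u2A aA] [u12 u1a u2a]] := (theta_end_mem, theta_end_neq).
have [pA_apart [pv1 pv2]] := off_neighbour_apart pC ap.
have [pA _ _ _] := theta_off_mem pC.
have [q [iq lq uq sq]] := path_in_junction (span12 (theta_l th)).
have far r : r \notin u1 :: q -> ~~ has (adj r) (u1 :: q) -> r \in A ->
    all (apart r) (v1 :: u1 :: rcons q v2).
  move=> rq nr rA; rewrite /= all_rcons.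
  have ru1 : r != u1 by apply: contraNneq rq => ->; rewrite mem_head.
  have ru2 : r != u2 by apply: contraNneq rq => ->; rewrite -lq mem_last.
  rewrite apart_sym theta_next_apart1 //= [apart r v2]apart_sym theta_next_apart2 //=.
  rewrite -[_ && _]/(all (apart r) (u1 :: q)); apply/allP => w wq.
  apply: real_on_apart => //; first exact: sq.
    by apply: contraNneq rq => ->.
  by apply: contra nr => rw; apply/hasP; exists w.
have aq : a \notin u1 :: q.
  rewrite inE eq_sym (negbTE u1a) /=; apply/negP => aq.
  case/splitPr: aq iq lq uq sq => q1 [|y q2]; rewrite last_cat /=.
    by move=> _ E; rewrite E eqxx in u2a.
  move=> /induced_path_suffix /and3P[xa /andP[xy _] /andP[ay _]] _ uq sq.
  have: uniq ((u1 :: q1) ++ a :: y :: q2) by [].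
  rewrite cat_uniq => /and3P[_ /hasPn/(_ a (mem_head _ _)) na /andP[ya _]].
  apply: (claw_heavy_oadj clawG (c := a) (x := p) (y := last u1 q1) (z := y)) => //.
  - by rewrite adj_sym.
  - apply: pA_apart; first by apply: sq; rewrite -cat_cons mem_cat mem_last.
    by apply: contraNneq na => <-; apply: mem_last.
  - apply: pA_apart; last by apply: contraNneq ya => ->; rewrite mem_head.
    by apply: sq; rewrite inE mem_cat !inE eqxx !orbT.
have pfar : all (apart p) (v1 :: u1 :: rcons q v2).
  rewrite /= all_rcons pv1 pv2 /= -[_ && _]/(all (apart p) (u1 :: q)).
  apply/allP => w wq; apply: pA_apart; first exact: sq.
  by apply: contraNneq aq => <-.
case: (boolP (has (adj a) (u1 :: q))) => [ha|na].
  have [Eq au1 au2 _] := attached_triangle iq lq uq sq aA aq ha ap pfar.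
  by move: iq; rewrite Eq /= => /andP[].
have [r [ir lr ur sr]] := path_in_junction (span_sym (span13 (theta_l th))).
exfalso; pose N z := (z \in u1 :: q) || has (adj z) (u1 :: q).
have ipr : induced_path p (a :: r).
  rewrite /= adj_sym ap ir andbT; apply/allP => w wr; apply: pA_apart.
    by apply: sr; rewrite inE wr orbT.
  by apply: contraTneq ur => <-; rewrite /= wr.
have Np : ~~ N p.
  rewrite negb_or; apply/andP; split; first by apply: contra pA => /sq.
  apply/hasPn => w wq; have := allP pfar w.
  rewrite inE -rcons_cons mem_rcons inE wq !orbT => /(_ isT) /apart_adjN ->.
  by [].
have Na : ~~ N a by rewrite negb_or aq.
have Nr : has N r.
  apply/hasP; exists u1; last by rewrite /N mem_head.
  case: r lr {ir ur sr ipr} => [/= E|w r /= <-]; last exact: mem_last.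
  by move: u1a; rewrite E eqxx.
have [t' [t [z [tt' zt zt' [Nt' Nt Nz sub]]]]] := induced_path_first_hit ipr Np Na Nr.
have inA w : w != p -> w \in p :: a :: r -> w \in A.
  by rewrite inE => /negbTE -> /= /sr.
have farN w : w \in p :: a :: r -> ~~ N w -> all (apart w) (v1 :: u1 :: rcons q v2).
  case: (eqVneq w p) => [-> //|wp /(inA _ wp) wA]; rewrite negb_or => /andP[wq nw].
  exact: far.
have zp : z != p by apply: contraTneq Nz => ->.
have [t'r tr zr] : [/\ t' \in p :: a :: r, t \in p :: a :: r & z \in p :: a :: r].
  by split; apply: sub; rewrite !inE eqxx ?orbT.
have zq : z \notin u1 :: q.
  apply: contra Nt => zq; apply/orP; right; apply/hasP; exists z => //.
  by rewrite adj_sym.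
have hz : has (adj z) (u1 :: q) by move: Nz; rewrite /N (negbTE zq).
have [_ _ _ /(_ t')] := attached_triangle iq lq uq sq (inA z zp zr) zq hz zt (farN t tr Nt).
by rewrite (farN t' t'r Nt') => /(_ tt' zt').
Qed.

Hypothesis H11G : H_heavy H11 G.
Hypothesis heavyC : forall x, #|G| <= (degree x).*2 -> x \in C.

Lemma off_apart y z : y \notin C -> z \notin C -> y != z -> ~~ adj y z -> apart y z.
Proof.
move=> yC zC yz nyz; apply/apartP; split=> //.
have ly : (degree y).*2 < #|G| by rewrite ltnNge; apply: contra yC => /heavyC.
have lz : (degree z).*2 < #|G| by rewrite ltnNge; apply: contra zC => /heavyC.
by rewrite -ltn_double doubleD -[#|G|.*2]addnn -addSn leq_add // ltnW.
Qed.

Lemma exits_apart_next : [/\ apart u1 v2, apart u2 v1, apart a v1 & apart a v2].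
Proof.
have [[u1A u2A aA] [u12 u1a u2a]] := (theta_end_mem, theta_end_neq).
split; rewrite apart_sym; [apply: theta_next_apart2 | apply: theta_next_apart1
  | apply: theta_next_apart1 | apply: theta_next_apart2] => //;
  by rewrite eq_sym.
Qed.

Lemma hourglass_contradiction p z : p \notin C -> adj a p -> adj a z -> adj p z ->
  apart z u1 -> apart z u2 -> apart z v1 -> apart z v2 -> False.
Proof.
move=> pC ap az pz zu1 zu2 zv1 zv2.
have [[u1A u2A aA] [u12 u1a u2a]] := (theta_end_mem, theta_end_neq).
have [[uv1 uv2] [u1v2 u2v1 av1 av2]] := (theta_next_adj, exits_apart_next).
have [pA [pv1 pv2]] := off_neighbour_apart pC ap.
have [adj12 au1 au2] := exits_triangle pC ap.
apply: (H11_heavy_apart H11G (c := a) (a := u1) (b := u2) (d := p) (e := z)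
  (a' := v1) (b' := v2)) => //; try by rewrite apart_sym.
- by rewrite apart_sym pA.
- by rewrite apart_sym pA.
- exact: theta_next_apart12.
Qed.

Lemma tail_contradiction p z : p \notin C -> adj a p -> adj p z -> apart a z ->
  apart z u1 -> apart z u2 -> apart z v1 -> apart z v2 -> False.
Proof.
move=> pC ap pz az zu1 zu2 zv1 zv2.
have [[u1A u2A aA] [u12 u1a u2a]] := (theta_end_mem, theta_end_neq).
have [[uv1 uv2] [u1v2 u2v1 av1 av2]] := (theta_next_adj, exits_apart_next).
have [pA [pv1 pv2]] := off_neighbour_apart pC ap.
have [adj12 au1 au2] := exits_triangle pC ap.
apply: (N112_heavy_apart N112G (a := u1) (b := u2) (c := a) (a' := v1) (b' := v2)
  (c' := p) (c'' := z)) => //; try by rewrite 1?adj_sym 1?apart_sym.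
- by rewrite apart_sym pA.
- by rewrite apart_sym pA.
- exact: theta_next_apart12.
Qed.

Lemma off_neighbour_unique p z :
  p \notin C -> adj a p -> z \notin C -> adj a z -> z = p.
Proof.
move=> pC ap zC az; apply/eqP/negPn/negP => zp.
have [[u1A u2A aA] [u12 u1a u2a]] := (theta_end_mem, theta_end_neq).
have [pA _] := off_neighbour_apart pC ap.
have [zA [zv1 zv2]] := off_neighbour_apart zC az.
have [_ au1 _] := exits_triangle pC ap.
case: (boolP (adj p z)) => [pz|npz].
  by apply: (hourglass_contradiction pC ap az pz) => //; apply: zA.
apply: (claw_heavy_oadj clawG ap az au1); [|exact: pA|exact: zA].
by apply: off_apart; rewrite // eq_sym.
Qed.

Lemma theta_end_contradiction x p :
  path (@adj G) x p -> uniq (x :: p) -> ~~ has (mem C) (x :: p) ->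
  adj a x -> adj (last x p) b ->
  (forall y z, y \notin C -> z \notin C -> adj a y -> adj y z ->
    (forall t, t \notin C -> adj a t -> t = y) -> degree a + degree z < #|G|) ->
  (forall y, (forall t, t \notin C -> adj a t -> t = y) -> ~~ adj a b ->
    degree a + degree b < #|G|) -> False.
Proof.
move=> pp up nC ax pb tail_deg chord_deg.
have [[u1A u2A aA] [u12 u1a u2a]] := (theta_end_mem, theta_end_neq).
have xC : x \notin C by apply: contra nC => xC; rewrite /= xC.
have uniq_a t : t \notin C -> adj a t -> t = x by move=> tC; apply: off_neighbour_unique.
case: p pp up nC pb => [|y p] pp up nC pb.
  have offQ : off C [:: x] by rewrite /off.
  have lQ : link a [:: x] b by rewrite /link /= !adj_oadj.
  have [_ bB] := span_mem (span13 (theta_r th)).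
  have ub := theta_r_uniq th; rewrite /= !inE !negb_or !andbT in ub.
  have [/andP[_ w1b] w2b] := andP ub.
  have uniq_th := theta_uniq C_uniq th.
  have nb v : v \in (v1 :: J1) ++ v2 :: J2 -> v != b.
    move=> vJ; apply: contraTneq uniq_th => Ev.
    rewrite cat_uniq [uniq (B ++ _)]cat_uniq !negb_and; apply/orP; right.
    apply/orP; right; apply/orP; right; apply/orP; left; rewrite negbK.
    by apply/hasP; exists v; rewrite // Ev.
  have b_apart r : r \in A -> r != a -> apart b r.
    move=> rA ra; rewrite apart_sym /apart /= (theta_disjoint C_uniq th rA bB) /=.
    apply/negP => /(theta_cross C_uniq C_max th offQ lQ rA bB).
    case=> [[_ E]|[[_ E]|[E _]]]; first by rewrite E eqxx in w1b.
      by rewrite E eqxx in w2b.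
    by rewrite E eqxx in ra.
  have bv1 : apart b v1.
    rewrite apart_sym /apart /= nb ?mem_head //=.
    exact: (far_end_apart_next C_uniq C_max th offQ lQ).
  have bv2 : apart b v2.
    rewrite apart_sym /apart /= nb ?mem_cat ?mem_head ?orbT //=.
    exact: (far_end_apart_next C_uniq C_max (theta_swap th) offQ lQ).
  have [bu1 bu2] : apart b u1 /\ apart b u2 by split; apply: b_apart.
  case: (boolP (adj a b)) => ab; first exact: (hourglass_contradiction xC ax ab pb).
  apply: (tail_contradiction xC ax pb) => //; apply/apartP; split=> //.
    exact: (theta_disjoint C_uniq th aA bB).
  exact: chord_deg uniq_a ab.
have [xy xy_neq] : adj x y /\ y != x.
  move: pp up => /= /andP[xy _] /andP[]; rewrite inE negb_or eq_sym.
  by case/andP.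
have yC : y \notin C by apply: contra nC => yC; rewrite /= yC orbT.
have [yA [yv1 yv2]] : (forall r, r \in A -> r != a -> apart y r) /\
    (apart y v1 /\ apart y v2).
  apply: (@off_tail_apart x y [:: y]) => //=; first by rewrite xy.
    by rewrite inE eq_sym xy_neq.
  by rewrite orbF negb_or; apply/andP.
apply: (tail_contradiction xC ax xy) => //; try exact: yA.
apply/apartP; split; last exact: tail_deg xC yC ax xy uniq_a.
  by apply: contraNneq yC => <-; rewrite (theta_mem th) aA.
by apply: contra xy_neq => /(uniq_a _ yC) ->.
Qed.

End ThetaEnd.

Section DegreeCounts.
Variable G : sgraph.
Implicit Types (a b p x y z : G) (C D L M Q : seq G).
Variable C : seq G.
Hypothesis C_uniq : uniq C.
Hypothesis C_max :
  forall t, ucycle (@oadj G) t -> {subset C <= t} -> size t <= size C.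

Lemma oadj_path x D : path (@adj G) x D -> path (@oadj G) x D.
Proof. by apply: sub_path => y z; apply: adj_oadj. Qed.

Lemma span_real x D : path (@adj G) x D -> span (x :: D) x (last x D).
Proof. by move/oadj_path; apply: span_path. Qed.

Lemma off_degree_unique a p :
  (forall t, t \notin C -> adj a t -> t = p) ->
  #|[set t | adj a t & t \notin C]| <= 1.
Proof.
move=> ua; rewrite -(cards1 p); apply/subset_leq_card/subsetP => t.
by rewrite !inE => /andP[at_ tC]; rewrite (ua t).
Qed.

Lemma tail_degree_sum a x D p z : perm_eq (a :: x :: D) C ->
  path (@adj G) a (x :: D) -> adj (last x D) a -> oadj x (last x D) ->
  p \notin C -> z \notin C -> adj a p -> adj p z ->
  (forall t, t \notin C -> adj a t -> t = p) ->
  degree a + degree z < #|G|.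
Proof.
move=> eqC /= /andP[ax pD] la xl pC zC ap pz ua.
have pz_neq : p != z by apply: adj_neq.
have offQ : off C [:: p; z].
  by rewrite /off /= !inE pz_neq negb_or pC orbF zC.
have spQ : span [:: p; z] p z by apply: (span_real (D := [:: z])); rewrite /= pz.
have no y : span (a :: x :: D) a y -> ~~ adj z y.
  move=> sp; apply/negP => zy; apply: (no_detour C_uniq C_max eqC sp offQ spQ).
    exact: adj_oadj.
  by rewrite oadj_sym adj_oadj.
have steps : path (fun y y' => ~~ (adj z y && adj a y')) x D.
  apply/negPn/negP => nb; have [D1 [y' [D2 [ED]]]] := path_breakP nb; rewrite negbK.
  case/andP=> zy ay'; suff: ~~ adj z (last x D1) by rewrite zy.
  apply: no.
  move: pD xl; rewrite ED last_cat cat_path /= => /and3P[p1 _ p2] xl.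
  apply: (@span_perm _ ([:: a] ++ (y' :: D2) ++ (x :: D1))); first by perm_count.
  apply: span_cat (span1 a) (adj_oadj ay') _.
  apply: span_cat (span_real p2) _ (span_real p1).
  by rewrite oadj_sym.
have zl : ~~ adj z (last x D).
  by apply: no; apply: (span_real (D := x :: D)); rewrite /= ax.
have za : ~~ adj z a.
  by apply/negP; rewrite adj_sym => /(ua _ zC) E; rewrite E eqxx in pz_neq.
have off_z : #|[set t | adj z t & t \notin C]| < #|[set t : G | t \notin C]|.
  rewrite [X in _ < X](cardsD1 z) inE zC add1n ltnS.
  apply/subset_leq_card/subsetP => t; rewrite !inE => /andP[zt ->].
  by rewrite andbT eq_sym adj_neq.
have off_a := off_degree_unique ua.
have := count_consecutive steps; have := card_notin C_uniq.
rewrite (degree_split a C_uniq) (degree_split z C_uniq) -!(permP eqC) -(perm_size eqC).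
rewrite /= adj_irrefl ax (negbTE za) (negbTE zl).
move: off_z off_a; set oz := #|[set t | adj z t & _]|; set o := #|[set t | t \notin C]|.
set oa := #|[set t | adj a t & _]|; set n := #|G|.
by move: oz o oa n (count _ _) (count _ _) (nat_of_bool (adj z x)) (size D); clear; lia.
Qed.

Lemma half_cycle_count a b x L y M Q q r : perm_eq (a :: (x :: L) ++ b :: y :: M) C ->
  path (@adj G) a ((x :: L) ++ b :: y :: M) -> adj (last y M) a ->
  oadj x (last y M) -> oadj (last x L) y ->
  off C Q -> span Q q r -> oadj a q -> oadj b r -> ~~ adj a b ->
  count (adj a) (x :: L) + count (adj b) (x :: L) <= size L.
Proof.
move=> eqC pC la xl ly offQ spQ aq br nab.
move: pC; rewrite cat_path /= => /and3P[/andP[ax pL] lb /andP[by_ pM]].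
have no D : perm_eq D C -> span D a b -> False.
  by move=> eqD sp; apply: (no_detour C_uniq C_max eqD sp offQ spQ).
have steps : path (fun z z' => ~~ (adj a z && adj b z')) x L.
  apply/negPn/negP => nb; have [L1 [z' [L2 [EL]]]] := path_breakP nb; rewrite negbK.
  case/andP=> az bz'; move: pL ly; rewrite EL last_cat cat_path /=.
  case/and3P=> p1 _ p2 /= ly.
  apply: (no ([:: a] ++ (x :: L1) ++ (y :: M) ++ (z' :: L2) ++ [:: b])).
    by rewrite EL in eqC; perm_count.
  apply: span_cat (span1 a) (adj_oadj az) _.
  apply: span_cat (span_sym (span_real p1)) xl _.
  have z'b : oadj z' b by rewrite oadj_sym adj_oadj.
  apply: span_cat (span_sym (span_real pM)) _
    (span_cat (span_sym (span_real p2)) z'b (span1 b)).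
  by rewrite oadj_sym.
have al : ~~ adj a (last x L).
  apply/negP => al; apply: (no ([:: a] ++ (x :: L) ++ (y :: M) ++ [:: b])).
    by perm_count.
  apply: span_cat (span1 a) (adj_oadj al) _.
  apply: span_cat (span_sym (span_real pL)) xl _.
  apply: span_cat (span_sym (span_real pM)) _ (span1 b).
  by rewrite oadj_sym adj_oadj.
have bx : ~~ adj b x.
  apply/negP => bx; apply: (no ([:: a] ++ (y :: M) ++ (x :: L) ++ [:: b])).
    by perm_count.
  apply: span_cat (span1 a) (_ : oadj a (last y M)) _.
    by rewrite oadj_sym adj_oadj.
  apply: span_cat (span_sym (span_real pM)) (_ : oadj y (last x L)) _.
    by rewrite oadj_sym.
  apply: span_cat (span_sym (span_real pL)) _ (span1 b).
  by rewrite oadj_sym adj_oadj.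
apply: leq_trans (count_consecutive steps) _.
by rewrite (negbTE al) (negbTE bx) !addn0.
Qed.

Lemma chord_degree_sum a b x L y M Q q r p :
  perm_eq (a :: (x :: L) ++ b :: y :: M) C ->
  path (@adj G) a ((x :: L) ++ b :: y :: M) -> adj (last y M) a ->
  oadj x (last y M) -> oadj (last x L) y ->
  off C Q -> span Q q r -> oadj a q -> oadj b r ->
  (forall t, t \notin C -> adj a t -> t = p) -> ~~ adj a b ->
  degree a + degree b < #|G|.
Proof.
move=> eqC pC la xl ly offQ spQ aq br ua nab.
have halfL := half_cycle_count eqC pC la xl ly offQ spQ aq br nab.
have halfM : count (adj b) (y :: M) + count (adj a) (y :: M) <= size M.
  apply: (@half_cycle_count b a y M x L Q r q) => //.
  - by perm_count.
  - move: pC; rewrite !cat_path /= => /and3P[/andP[-> ->] _ /andP[-> ->]].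
    by rewrite la.
  - by move: pC; rewrite cat_path /= => /and3P[].
  - by rewrite oadj_sym.
  - by rewrite oadj_sym.
  - exact: span_sym.
  - by rewrite adj_sym.
have off_a := off_degree_unique ua.
have off_b : #|[set t | adj b t & t \notin C]| <= #|[set t : G | t \notin C]|.
  by apply/subset_leq_card/subsetP => t; rewrite !inE => /andP[].
have := card_notin C_uniq.
rewrite (degree_split a C_uniq) (degree_split b C_uniq) -!(permP eqC) -(perm_size eqC).
rewrite /= !count_cat size_cat /= !adj_irrefl [adj b a]adj_sym (negbTE nab).
by move: halfL halfM off_b off_a => /=; clear; lia.
Qed.

End DegreeCounts.

Section LongestCycle.
Variable G : sgraph.
Variable C : seq G.
Hypothesis C_uniq : uniq C.
Hypothesis C_max :
  forall t, ucycle (@oadj G) t -> {subset C <= t} -> size t <= size C.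
Hypothesis heavyC : forall x, #|G| <= (degree x).*2 -> x \in C.
Hypothesis clawG : H_heavy claw G.
Hypothesis N112G : H_heavy N112 G.
Hypothesis H11G : H_heavy H11 G.
Implicit Types (a b x y z s : G) (L M D q : seq G).

Record frame a b x L y M s q : Prop := Frame {
  frame_perm : perm_eq (a :: (x :: L) ++ b :: y :: M) C;
  frame_path : path (@adj G) a ((x :: L) ++ b :: y :: M);
  frame_close : adj (last y M) a;
  frame_l : oadj x (last y M);
  frame_r : oadj (last x L) y;
  frame_off_path : path (@adj G) s q;
  frame_off_uniq : uniq (s :: q);
  frame_off : ~~ has (mem C) (s :: q);
  frame_start : adj a s;
  frame_stop : adj (last s q) b }.

Lemma frame_sym a b x L y M s q : frame a b x L y M s q ->
  frame b a y M x L (last s q) (rev (belast s q)).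
Proof.
case=> eqC pC la xl ly pq uq nq as_ qb.
have revq : last s q :: rev (belast s q) = rev (s :: q).
  by rewrite [s :: q]lastI rev_rcons.
split; rewrite ?revq ?rev_uniq ?has_rev //.
- by perm_count.
- move: pC; rewrite !cat_path /= => /and3P[/andP[-> ->] _ /andP[-> ->]].
  by rewrite la.
- by move: pC; rewrite cat_path /= => /and3P[].
- by rewrite oadj_sym.
- by rewrite oadj_sym.
- by rewrite adj_path_rev.
- by rewrite adj_sym.
- rewrite -[last _ _]/(last s (last s q :: rev (belast s q))) revq rev_cons last_rcons.
  by rewrite adj_sym.
Qed.

Lemma frame_end a b x L y M s q A B u1 u2 w1 w2 I1 I2 :
  frame a b x L y M s q -> theta C a b A B u1 u2 w1 w2 I1 I2 ->
  I1 != [::] -> I2 != [::] -> saturated A u1 u2 I1 I2 -> real_on A -> False.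
Proof.
case=> eqC pC la xl ly pq uq nq as_ qb.
case: I1 => [|v1 J1] // th _; case: I2 th => [|v2 J2] // th _ satA realA.
have offQ : off C (s :: q) by apply/and3P.
have spQ := span_real pq.
apply: (theta_end_contradiction C_uniq C_max clawG N112G th satA realA H11G heavyC
  pq uq nq as_ qb) => [p z pC' zC ap pz ua | p ua nab].
- apply: (tail_degree_sum C_uniq C_max eqC pC _ _ pC' zC ap pz ua).
    by rewrite last_cat.
  by rewrite last_cat.
- by apply: (chord_degree_sum C_uniq C_max eqC pC la xl ly offQ spQ _ _ ua nab);
     rewrite adj_oadj // adj_sym.
Qed.

Lemma cycle_neighbours_oadj a x D z : perm_eq (a :: x :: D) C ->
  path (@adj G) a (x :: D) -> adj (last x D) a -> D != [::] ->
  z \notin C -> adj a z -> oadj x (last x D).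
Proof.
move=> eqC pC la D0 zC az; have /= /andP[ax pD] := pC.
have offz : off C [:: z] by rewrite /off /= orbF.
have z_apart y : y \in C -> span (a :: x :: D) a y -> apart z y.
  move=> yC sp; rewrite /apart /=; apply/andP; split.
    by apply: contraNneq zC => ->.
  apply/negP => zy; apply: (no_detour C_uniq C_max eqC sp offz (span1 z)).
    exact: adj_oadj.
  by rewrite oadj_sym.
apply/negPn/negP => nxl.
apply: (claw_heavy_oadj clawG (c := a) (x := z) (y := x) (z := last x D)) => //.
- by rewrite adj_sym.
- apply: z_apart; first by rewrite -(perm_mem eqC) !inE eqxx orbT.
  have al : oadj a (last x D) by rewrite oadj_sym adj_oadj.
  exact: span_cat (span1 a) al (span_sym (span_real pD)).
- apply: z_apart; first by rewrite -(perm_mem eqC) inE mem_last orbT.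
  exact: span_real pC.
- rewrite /apart /= nxl andbT; apply/eqP => E.
  have: uniq (x :: D) by move: C_uniq; rewrite -(perm_uniq eqC) => /andP[].
  by case: D D0 E {eqC pC la pD z_apart nxl} => // d D _ /= ->; rewrite mem_last.
Qed.

Lemma frame_contradiction a b x L y M s q : frame a b x L y M s q -> False.
Proof.
move=> fr; case: (fr) => eqC pC la xl ly pq uq nq as_ qb.
have offQ : off C (s :: q) by apply/and3P.
have spQ := span_real pq.
have bq : oadj b (last s q) by rewrite oadj_sym adj_oadj.
have no D : perm_eq D C -> span D a b -> False.
  by move=> eqD sp; apply: (no_detour C_uniq C_max eqD sp offQ spQ (adj_oadj as_) bq).
move: (pC); rewrite cat_path /= => /and3P[/andP[ax pL] lb /andP[by_ pM]].
have yb : oadj y b by rewrite oadj_sym adj_oadj.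
have al : oadj a (last y M) by rewrite oadj_sym adj_oadj.
case/lastP: L => [|I1 w1] in fr eqC pC xl ly pL lb *.
  apply: (no ([:: a] ++ [:: x] ++ (y :: M) ++ [:: b])); first by perm_count.
  apply: span_cat (span1 a) (adj_oadj ax) (span_cat (span1 x) xl _).
  exact: span_cat (span_sym (span_real pM)) yb (span1 b).
case/lastP: M => [|I2 u2] in fr eqC pC xl ly la al pM *.
  apply: (no ([:: a] ++ [:: y] ++ (x :: rcons I1 w1) ++ [:: b])); first by perm_count.
  have yx : oadj y x by rewrite oadj_sym.
  apply: span_cat (span1 a) al (span_cat (span1 y) yx _).
  exact: span_cat (span_real pL) (adj_oadj lb) (span1 b).
rewrite !last_rcons in xl ly lb la al.
have eqC' : perm_eq ([:: x; u2; a] ++ [:: w1; y; b] ++ I1 ++ rev I2) C.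
  by move: eqC; rewrite -!cats1 => eqC; perm_count.
have uC : uniq ([:: x; u2; a] ++ [:: w1; y; b] ++ I1 ++ rev I2).
  by rewrite (perm_uniq eqC').
have th : theta C a b [:: x; u2; a] [:: w1; y; b] x u2 w1 y I1 (rev I2).
  split.
  - by apply: junction_triangle; rewrite // oadj_sym // adj_oadj.
  - apply: junction_triangle => //; exact: adj_oadj.
  - by move: uC; rewrite cat_uniq => /andP[].
  - by move: uC; rewrite cat_uniq => /and3P[_ _]; rewrite cat_uniq => /andP[].
  - exact: pL.
  - by rewrite -adj_path_rev last_rcons belast_rcons rev_cons revK.
  - exact: eqC'.
have [A [B [u1' [u2' [w1' [w2' [K1 [K2 [th' satA satB]]]]]]]]] := theta_saturate C_uniq th.
have K1n : K1 != [::].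
  apply/eqP => E; rewrite E in th'.
  exact: (theta_nonempty C_uniq C_max offQ spQ (adj_oadj as_) bq th').
have K2n : K2 != [::].
  apply/eqP => E; rewrite E in th'.
  exact: (theta_nonempty C_uniq C_max offQ spQ (adj_oadj as_) bq (theta_swap th')).
have lQ : link a (s :: q) b.
  by apply: link_adj; rewrite /= as_ rcons_path pq.
have [realA|realB] := theta_real C_uniq C_max th' offQ lQ.
  exact: frame_end fr th' K1n K2n satA realA.
apply: (frame_end (frame_sym fr) (theta_rev th') _ _ satB realB).
- by rewrite -size_eq0 size_rev size_eq0.
- by rewrite -size_eq0 size_rev size_eq0.
Qed.

End LongestCycle.

Theorem theorem9 (G : sgraph) :
  k_connected 2 G ->
  family_heavy [:: claw; N112; H11] G ->
  hamiltonian G.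
Proof.
move=> connG heavyG.
have clawG : H_heavy claw G by apply: heavyG; left.
have N112G : H_heavy N112 G by apply: heavyG; right; left.
have H11G : H_heavy H11 G by apply: heavyG; right; right; left.
have [C [cC C3 heavyC C_max]] := maximal_cycle connG.
have [cycC C_uniq] := andP cC.
exists C; split=> // z; apply/negPn/negP => zC; exfalso.
have exz : exists z, z \notin C by exists z.
have [a [b [s [q [[aC bC ab] [pq uq as_ qb nq]]]]]] :=
  bridging_path connG (ltnW C3) C_uniq exz.
case: (rot_to aC) => i D ED.
have eqD : perm_eq (a :: D) C by rewrite -ED perm_rot.
have bD : b \in D by move: bC; rewrite -(perm_mem eqD) inE eq_sym (negbTE ab).
have : cycle (@adj G) (a :: D) by rewrite -ED rot_cycle.
case/splitPr: bD eqD => L M eqC.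
rewrite /= rcons_path last_cat => /andP[pC la].
have offQ : off C (s :: q) by apply/and3P.
have spQ := span_real pq.
have bq : oadj b (last s q) by rewrite oadj_sym adj_oadj.
have no D' : perm_eq D' C -> span D' a b -> False.
  by move=> eqD sp; apply: (no_detour C_uniq C_max eqD sp offQ spQ (adj_oadj as_) bq).
have sC : s \notin C by apply: contra nq => sC; rewrite /= sC.
have qC : last s q \notin C.
  by apply: contra nq => qC; apply/hasP; exists (last s q) => //; apply: mem_last.
case: L => [|x L] in eqC pC la *.
  apply: (no ([:: a] ++ b :: M)) => //; apply: span_cat (span1 a) _ _.
    by rewrite oadj_sym; apply: adj_oadj la.
  by apply/span_sym/span_real; move: pC => /= /andP[].
case: M => [|y M] in eqC pC la *.
  apply: (no (a :: (x :: L) ++ [:: b])) => //.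
  by have := span_real pC; rewrite last_cat.
move: (pC); rewrite cat_path /= => /and3P[/andP[ax pL] lb /andP[by_ pM]].
apply: (frame_contradiction C_uniq C_max heavyC clawG N112G H11G
  (a := a) (b := b) (x := x) (L := L) (y := y) (M := M) (s := s) (q := q)).
split=> //.
- have := cycle_neighbours_oadj C_uniq C_max clawG eqC pC _ _ sC as_.
  rewrite last_cat; apply=> //; by case: (L).
- have := @cycle_neighbours_oadj _ _ C_uniq C_max clawG b y (M ++ a :: x :: L) (last s q).
  rewrite last_cat /= oadj_sym; apply=> //.
  + by perm_count.
  + by rewrite cat_path /= by_ pM la ax pL.
  + by case: (M).
  + by rewrite adj_sym.
Qed.
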